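(* Let $n,k,l\in\mathbb{N}$ with $n\geq k\geq l$, let $d$ be a non-negative integer, and let $X$ be a compact Hausdorff space with $\dim X\leq d$. If $\pi_r(S(n,k,l))=0$ for each $r\leq d$, then $C(X,S(n,k,l))$ is path connected.
   Context: $\mathbb{N}$ denotes the positive integers. For $n\geq k\geq l$ in $\mathbb{N}$, $S(n,k,l)=\{b\in M_n(\mathbb{C}) : b \text{ is non-negative definite and } l\leq \operatorname{rank}(b)\leq k\}$, with the subspace topology induced by the norm topology of $M_n(\mathbb{C})$. $\dim X$ is the covering dimension of $X$. $\pi_r$ denotes the $r$-th homotopy group (set, for $r=0$), $r$ ranging over integers $0\le r\le d$; the vanishing of $\pi_0$ means path connectedness. $C(X,S(n,k,l))$ is the set of continuous maps $X\to S(n,k,l)$, viewed as a subset of $C(X,M_n(\mathbb{C}))$ with the supremum norm topology; a path in it is the same as a homotopy $X\times[0,1]\to S(n,k,l)$. *)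

(* Defs.v *)
From HB Require Import structures.
From mathcomp Require Import all_boot all_order all_algebra.
From mathcomp Require Import sesquilinear spectral.
From mathcomp Require Import all_classical all_reals all_analysis.
From mathcomp.real_closed Require Export complex.

Set Implicit Arguments.
Unset Strict Implicit.
Unset Printing Implicit Defensive.

Import Order.TTheory GRing.Theory Num.Theory.
Import numFieldNormedType.Exports.

Local Open Scope classical_set_scope.
Local Open Scope ring_scope.
Local Open Scope sesquilinear_scope.

(* R[i] carries no topology in the libraries; it gets the one of its norm. The
   matrix types 'M[R[i]]_n then inherit the topology of entrywise uniform
   convergence, which is that of any norm. *)
HB.instance Definition _ (R : realType) := NormedModule.copy R[i] R[i]^o.

(* In the order of R[i], [0 <= z] means that z is real and nonnegative, so
   these matrices are Hermitian. *)
Definition nonneg_definite (R : realType) (n : nat) (b : 'M[R[i]]_n) : Prop :=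
  forall v : 'cV[R[i]]_n, 0 <= (v ^t* *m b *m v) 0 0.

Definition psd_rank (R : realType) (n k l : nat) : set 'M[R[i]]_n :=
  [set b | nonneg_definite b /\ (l <= \rank b <= k)%N].
Arguments psd_rank R n k l : clear implicits.

(* Counting indices instead of distinct members of the refinement is harmless,
   since repeated members can be discarded. *)
Definition covering_dim_le (X : topologicalType) (d : nat) : Prop :=
  forall (p : nat) (U : 'I_p -> set X),
    (forall i, open (U i)) -> \bigcup_i U i = [set: X] ->
    exists (q : nat) (V : 'I_q -> set X),
      [/\ forall j, open (V j),
          \bigcup_j V j = [set: X],
          forall j, exists i, V j `<=` U i
        & forall x, (#|[set j : 'I_q | `[< V j x >]]%SET| <= d.+1)%N].

Definition path_connected (R : realType) (T : topologicalType) (A : set T) :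
    Prop :=
  forall x y, A x -> A y ->
    exists g : R -> T,
      [/\ {within `[0, 1], continuous g}, g 0 = x, g 1 = y
        & forall t, 0 <= t <= 1 -> A (g t)].
Arguments path_connected R {T} A.

Definition cube (R : realType) (r : nat) : set 'rV[R]_r :=
  [set s | forall i, 0 <= s 0 i <= 1].
Arguments cube R r : clear implicits.

Definition cube_boundary (R : realType) (r : nat) : set 'rV[R]_r :=
  [set s | cube R r s /\ exists i, s 0 i = 0 \/ s 0 i = 1].
Arguments cube_boundary R r : clear implicits.

(* Maps on the cube are represented by total functions on R^r; [sphere_map] and
   [homotopic] only depend on their values on the cube. For r = 0 the cube is a
   point with empty boundary. *)
Definition sphere_map (R : realType) (T : topologicalType) (Y : set T)
    (y0 : T) (r : nat) : set ('rV[R]_r -> T) :=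
  [set f | [/\ {within cube R r, continuous f},
               forall s, cube R r s -> Y (f s)
             & forall s, cube_boundary R r s -> f s = y0]].

Definition homotopic (R : realType) (T : topologicalType) (Y : set T)
    (y0 : T) (r : nat) (f g : 'rV[R]_r -> T) : Prop :=
  exists H : 'rV[R]_r * R -> T,
    [/\ {within cube R r `*` `[0, 1], continuous H},
        forall s, cube R r s -> H (s, 0) = f s,
        forall s, cube R r s -> H (s, 1) = g s
      & forall t, 0 <= t <= 1 -> sphere_map Y y0 (fun s => H (s, t))].

(* The underlying set of pi_r(Y, y0), whose elements are homotopy classes. *)
Definition homotopy_group (R : realType) (T : topologicalType) (Y : set T)
    (y0 : T) (r : nat) : set (set ('rV[R]_r -> T)) :=
  [set [set g | sphere_map Y y0 g /\ homotopic Y y0 f g]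
     | f in @sphere_map R T Y y0 r].
Arguments homotopy_group R {T} Y y0 r.

(* A group is zero iff its underlying set is a singleton. In degree 0 the classes
   are the path components of Y, whatever the base point. *)
Definition homotopy_group_zero (R : realType) (T : topologicalType)
    (Y : set T) (r : nat) : Prop :=
  forall y0, Y y0 -> exists c, homotopy_group R Y y0 r = [set c].
Arguments homotopy_group_zero R {T} Y r.

(* {uniform X -> _} is the type of all functions with the topology of uniform
   convergence, i.e. that of the supremum norm on continuous functions on a
   compact X. *)
Definition continuous_maps (X : topologicalType) (T : uniformType)
    (Y : set T) : set {uniform X -> T} :=
  [set f | continuous (f : X -> T) /\ forall x, Y (f x)].
Arguments continuous_maps X {T} Y.

(* Main.v *)
Require Import Defs.
From HB Require Import structures.
From mathcomp Require Import all_boot all_order all_algebra.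
From mathcomp Require Import sesquilinear spectral.
From mathcomp Require Import all_classical all_reals all_analysis.
From mathcomp Require Import ring lra zify.

(** Compressing the spectrum of a nonnegative definite matrix [a] by its
    (k+1)-st eigenvalue [x], that is, taking the positive part of [a - x], is a
    Lipschitz retraction [r] of the nonnegative definite matrices onto those of
    rank at most [k]. Since [rank >= l] is an open condition, [S(n,k,l)] is a
    retract, under [r], of a neighbourhood of itself in a convex set.

    Given [f : X -> S(n,k,l)], a fine cover of order at most [d + 1] yields a
    map [phi] from [X] to the cubical subdivision of its nerve (coordinates with
    maximum 1 and at most [d + 1] of them nonzero), and [f] is homotopic, by
    segments followed by [r], to [h o phi], where [h] is [r] of a weighted mean
    of values of [f]. Dropping the condition on the maximum turns this cubical
    complex into its cone with apex 0; the additional cubes have dimension at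
    most [d + 1], so [h] extends over them because the homotopy groups vanish.
    Contracting the cone to 0 makes [h o phi], hence [f], homotopic to a
    constant map to any prescribed point of [S(n,k,l)]. *)

Set Implicit Arguments.
Unset Strict Implicit.
Unset Printing Implicit Defensive.

Import Order.TTheory GRing.Theory Num.Theory.
Import numFieldNormedType.Exports.
Local Open Scope classical_set_scope.
Local Open Scope ring_scope.

(** * Truncation of nonnegative definite matrices *)

Section Psd.
Local Open Scope sesquilinear_scope.
Variable C : numClosedFieldType.

Definition psd n (b : 'M[C]_n) :=
  forall v : 'cV[C]_n, 0 <= (v ^t* *m b *m v) 0 0.

Lemma adjM m n p (a : 'M[C]_(m, n)) (b : 'M[C]_(n, p)) :
  (a *m b)^t* = b^t* *m a^t*.
Proof. by rewrite trmx_mul map_mxM. Qed.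

Lemma adjB m n (a b : 'M[C]_(m, n)) : (a - b)^t* = a^t* - b^t*.
Proof. by rewrite linearB /= map_mxB. Qed.

(** The square of the Frobenius norm. *)
Definition sqnorm m n (a : 'M[C]_(m, n)) := \sum_i \sum_j `|a i j| ^+ 2.

Lemma sqnormE m n (a : 'M[C]_(m, n)) : sqnorm a = \tr (a *m a^t*).
Proof.
apply: eq_bigr => i _; rewrite !mxE; apply: eq_bigr => j _.
by rewrite !mxE normCK.
Qed.

Lemma sqnorm_ge0 m n (a : 'M[C]_(m, n)) : 0 <= sqnorm a.
Proof.
by apply: sumr_ge0 => i _; apply: sumr_ge0 => j _; rewrite exprn_ge0.
Qed.

Lemma sqnorm_entry m n (a : 'M[C]_(m, n)) i j : `|a i j| ^+ 2 <= sqnorm a.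
Proof.
rewrite /sqnorm (bigD1 i) //= (bigD1 j) //= -addrA lerDl addr_ge0 //.
  by apply: sumr_ge0 => *; rewrite exprn_ge0.
by apply: sumr_ge0 => *; apply: sumr_ge0 => *; rewrite exprn_ge0.
Qed.

Lemma sqnorm_gt0 m n (a : 'M[C]_(m, n)) : a != 0 -> 0 < sqnorm a.
Proof.
move=> a0; rewrite lt_def sqnorm_ge0 andbT; apply: contra_neq a0 => s0.
apply/matrixP => i j; have := sqnorm_entry a i j; rewrite s0 mxE => h.
by apply/eqP; rewrite -normr_eq0 -sqrf_eq0 eq_le h exprn_ge0.
Qed.

Lemma sqnorm_cV n (v : 'cV[C]_n) : (v^t* *m v) 0 0 = sqnorm v.
Proof.
rewrite mxE; apply: eq_bigr => i _.
by rewrite big_ord1 !mxE normCK mulrC.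
Qed.

Lemma quad_gram m n (p : 'M[C]_(m, n)) (v : 'cV[C]_n) :
  (v^t* *m (p^t* *m p) *m v) 0 0 = sqnorm (p *m v).
Proof. by rewrite -sqnorm_cV adjM !mulmxA. Qed.

Lemma psd_gram m n (p : 'M[C]_(m, n)) : psd (p^t* *m p).
Proof. by move=> v; rewrite quad_gram sqnorm_ge0. Qed.

Lemma psdD n (a b : 'M[C]_n) : psd a -> psd b -> psd (a + b).
Proof. by move=> pa pb v; rewrite mulmxDr mulmxDl mxE addr_ge0. Qed.

Lemma psdZ n (t : C) (a : 'M[C]_n) : 0 <= t -> psd a -> psd (t *: a).
Proof. by move=> t0 pa v; rewrite -scalemxAr -scalemxAl mxE mulr_ge0. Qed.

Lemma psd0 n : psd (0 : 'M[C]_n).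
Proof. by move=> v; rewrite mulmx0 mul0mx mxE. Qed.

Lemma psd_sum n (I : finType) (w : I -> C) (a : I -> 'M[C]_n) :
  (forall i, 0 <= w i) -> (forall i, psd (a i)) -> psd (\sum_i w i *: a i).
Proof.
move=> w0 pa; elim/big_ind: _; [exact: psd0 | exact: psdD |].
by move=> i _; apply: psdZ.
Qed.

Lemma quad_delta n (b : 'M[C]_n) (i j : 'I_n) :
  ((delta_mx i 0 : 'cV_n)^t* *m b *m (delta_mx j 0 : 'cV_n)) 0 0 = b i j.
Proof. by rewrite trmx_delta map_delta_mx -rowE -colE !mxE. Qed.

Lemma quadD n (b : 'M[C]_n) (u w : 'cV[C]_n) (c : C) :
  ((u + c *: w)^t* *m b *m (u + c *: w)) 0 0 =
  (u^t* *m b *m u) 0 0 + c * (u^t* *m b *m w) 0 0 +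
  c^* * (w^t* *m b *m u) 0 0 + c^* * c * (w^t* *m b *m w) 0 0.
Proof.
have -> : (u + c *: w)^t* = u^t* + c^* *: w^t*.
  by apply/matrixP => x y; rewrite !mxE rmorphD rmorphM.
have DE (x y : 'M[C]_1) : (x + y) 0 0 = x 0 0 + y 0 0 by rewrite mxE.
have ZE t (x : 'M[C]_1) : (t *: x) 0 0 = t * x 0 0 by rewrite mxE.
rewrite mulmxDl mulmxDl !mulmxDr.
rewrite -!scalemxAl -!scalemxAr.
by rewrite !DE !ZE; ring.
Qed.

(** Polarization: the quadratic form at [delta_j + c delta_i] is real, hence so is
    [c * b j i + c^* * b i j]; the choices [c = 1] and [c = 'i] then determine the conjugate of
    [b j i]. *)
Lemma psd_herm n (b : 'M[C]_n) : psd b -> b^t* = b.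
Proof.
move=> pb; apply/matrixP => i j; rewrite !mxE.
have q c : c * b j i + c^* * b i j \is Num.real.
  have h := ger0_real (pb (delta_mx j 0 + c *: delta_mx i 0)).
  rewrite quadD !quad_delta in h.
  have ri := ger0_real (pb (delta_mx i 0)); rewrite quad_delta in ri.
  have rj := ger0_real (pb (delta_mx j 0)); rewrite quad_delta in rj.
  have h' := rpredB (rpredB h rj) (rpredM (rpredX 2 (normr_real c)) ri).
  apply: (eq_ind _ (fun z => z \is Num.real) h').
  by rewrite normCKC; ring.
have /CrealP := q 1; rewrite rmorph1 !mul1r rmorphD /= => h1.
have /CrealP := q 'i; rewrite rmorphD /= !rmorphM /= conjCK conjCi => h2.
have h3 : (b i j)^* - (b j i)^* = b j i - b i j.
  apply: (mulfI (neq0Ci C)); rewrite !mulrBr.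
  by rewrite !mulNr in h2; rewrite -h2 addrC.
have : (b j i)^* *+ 2 = b i j *+ 2.
  rewrite !mulr2n.
  have -> : (b j i)^* + (b j i)^* =
     (b j i)^* + (b i j)^* - ((b i j)^* - (b j i)^*) by ring.
  by rewrite h1 h3; ring.
by move=> /eqP; rewrite eqrMn2r => /orP[//|/eqP].
Qed.

Lemma rank_diag_le n (s : 'rV[C]_n) :
  (\rank (diag_mx s) <= #|[pred i | s 0 i != 0]%R|)%N.
Proof.
have -> : diag_mx s = \sum_(i | s 0 i != 0) s 0 i *: delta_mx i i.
  rewrite diag_mx_sum_delta [LHS](bigID (fun i => s 0 i != 0)) /=.
  rewrite [X in _ + X]big1 ?addr0 // => i; rewrite negbK => /eqP->.
  by rewrite scale0r.
rewrite -sum1_card; elim/big_ind2: _ => [|x1 x2 y1 y2 h1 h2|i _].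
- by rewrite mxrank0.
- exact: leq_trans (mxrank_add _ _) (leq_add h1 h2).
- by rewrite (leq_trans (mxrank_scale _ _)) ?mxrank_delta.
Qed.

(** Each term is bounded through [|v_i| |v_j| <= (|v_i|^2 + |v_j|^2) / 2]; summing over all pairs of
    indices yields the factor [n]. *)
Lemma quad_bound n (m : 'M[C]_n) (e : C) (v : 'cV[C]_n) :
  (forall i j, `|m i j| <= e) ->
  `|(v^t* *m m *m v) 0 0| <= n%:R * e * sqnorm v.
Proof.
move=> me.
have -> : (v^t* *m m *m v) 0 0 = \sum_j \sum_i (v i 0)^* * m i j * v j 0.
  by rewrite mxE; apply: eq_bigr => j _; rewrite mxE mulr_suml;
    apply: eq_bigr => i _; rewrite !mxE.
have sv : sqnorm v = \sum_i `|v i 0| ^+ 2.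
  by apply: eq_bigr => i _; rewrite big_ord1.
have e1 : \sum_(j < n) \sum_(i < n) (`|v i 0| ^+ 2 + `|v j 0| ^+ 2) =
    n%:R * sqnorm v *+ 2.
  under eq_bigr => j _ do rewrite big_split /=.
  rewrite big_split /= exchange_big /= -mulr2n; congr (_ *+ 2).
  rewrite exchange_big /= sumr_const card_ord -sv mulr_natl //.
have -> : n%:R * e * sqnorm v =
    \sum_(j < n) \sum_(i < n) e * (2^-1 * (`|v i 0| ^+ 2 + `|v j 0| ^+ 2)).
  under eq_bigr => j _ do under eq_bigr => i _ do rewrite mulrA.
  under eq_bigr => j _ do rewrite -mulr_sumr.
  by rewrite -mulr_sumr e1 -mulr_natl; field.
apply: le_trans (ler_norm_sum _ _ _) _; apply: ler_sum => j _.
apply: le_trans (ler_norm_sum _ _ _) _; apply: ler_sum => i _.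
rewrite !normrM norm_conjC -mulrA mulrCA.
have e0 : 0 <= e by apply: le_trans (me i j).
have vv : 0 <= `|v i 0| * `|v j 0| by apply: mulr_ge0.
apply: ler_pM (normr_ge0 _) vv (me i j) _.
have : 0 <= (`|v i 0| - `|v j 0|) ^+ 2.
  by rewrite real_exprn_even_ge0 // rpredB // normr_real.
rewrite sqrrB => h.
rewrite -subr_ge0.
suff -> : 2^-1 * (`|v i 0| ^+ 2 + `|v j 0| ^+ 2) - `|v i 0| * `|v j 0| =
   2^-1 * (`|v i 0| ^+ 2 - `|v i 0| * `|v j 0| *+ 2 + `|v j 0| ^+ 2).
  by rewrite mulr_ge0 // invr_ge0.
by field.
Qed.

(* [p^t* *m p] and [q^t* *m q] are the positive and negative parts of [a - x];
   the bounds on the ranks make [x] the (k+1)-st largest eigenvalue of [a]. *)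
Definition truncation n k (a : 'M[C]_n) (x : C) (p q : 'M[C]_n) :=
  [/\ x \is Num.real, a - x%:M = p^t* *m p - q^t* *m q, p *m q^t* = 0,
     (\rank p <= k)%N & (\rank q + k < n)%N].

(** The matrix that stacks [p] on [q] has rank less than [n], so its cokernel matrix has a nonzero
    column, which both [p] and [q] kill. *)
Lemma exists_common_kernel n (p q : 'M[C]_n) : (\rank p + \rank q < n)%N ->
  exists v : 'cV[C]_n, [/\ v != 0, p *m v = 0 & q *m v = 0].
Proof.
move=> lt_n; have : cokermx (col_mx p q) != 0.
  rewrite -mxrank_eq0 mxrank_coker -lt0n subn_gt0.
  apply: leq_ltn_trans lt_n; rewrite -addsmxE.
  exact: mxrank_adds_leqif.
case/matrix0Pn => i [j cij]; exists (col j (cokermx (col_mx p q))).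
have := mulmx_coker (col_mx p q); rewrite mul_col_mx.
rewrite -[0 in RHS]col_mx0 => /eq_col_mx[pc qc].
split; last 2 first.
- by rewrite colE mulmxA pc mul0mx.
- by rewrite colE mulmxA qc mul0mx.
apply: contra_neq cij => /colP/(_ i).
by rewrite !mxE.
Qed.

(* For [v] in the kernels of [p] and [q'], [v^t* *m a *m v <= x * |v|^2] while
   [v^t* *m a' *m v >= x' * |v|^2]. *)
Lemma truncation_shift_lip n k (a a' : 'M[C]_n) x x' p q p' q' (e : C) :
  truncation k a x p q -> truncation k a' x' p' q' ->
  (forall i j, `|a i j - a' i j| <= e) -> x' - x <= n%:R * e.
Proof.
move=> [rx ax _ rp rq] [rx' ax' _ rp' rq'] ae.
have [|v [v0 pv qv]] := @exists_common_kernel _ p q'.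
  by apply: leq_ltn_trans rq'; rewrite addnC leq_add2l.
have quad0 (b c d : 'M[C]_n) y : b - y%:M = c^t* *m c - d^t* *m d ->
    (v^t* *m b *m v) 0 0 = y * sqnorm v + sqnorm (c *m v) - sqnorm (d *m v).
  move=> /(congr1 (fun m => (v^t* *m (m + y%:M) *m v) 0 0)).
  rewrite subrK => ->; rewrite mulmxDr mulmxDl mulmxBr mulmxBl.
  rewrite mul_mx_scalar -scalemxAl.
  have -> (u w z : 'M[C]_1) : (u - w + y *: z) 0 0 = u 0 0 - w 0 0 + y * z 0 0.
    by rewrite !mxE.
  by rewrite !quad_gram sqnorm_cV; ring.
have := quad_bound v (m := a' - a) (e := e) _.
have me i j : `|(a' - a) i j| <= e by rewrite !mxE distrC.
move=> /(_ me); rewrite mulmxBr mulmxBl.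
have -> (u w : 'M[C]_1) : (u - w) 0 0 = u 0 0 - w 0 0 by rewrite !mxE.
rewrite (quad0 _ _ _ _ ax) (quad0 _ _ _ _ ax') pv qv.
have s0 : sqnorm (0 : 'cV[C]_n) = 0.
  by rewrite sqnormE mul0mx mxtrace0.
rewrite s0 subr0 addr0 => h; have sv := sqnorm_gt0 v0.
rewrite -(ler_pM2r sv); apply: le_trans h.
apply: (@le_trans _ _ (x' * sqnorm v + sqnorm (p' *m v) -
   (x * sqnorm v - sqnorm (q *m v)))).
  rewrite -subr_ge0.
  have -> : x' * sqnorm v + sqnorm (p' *m v) - (x * sqnorm v - sqnorm (q *m v))
    - (x' - x) * sqnorm v = sqnorm (p' *m v) + sqnorm (q *m v) by ring.
  by rewrite addr_ge0 // sqnorm_ge0.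
apply: real_ler_norm.
by rewrite !(rpredB, rpredD, rpredM) // ger0_real // sqnorm_ge0.
Qed.

(* Taking the positive part is a contraction for the Frobenius norm. *)
Lemma sqnorm_gramB_le m n (p q p' q' : 'M[C]_(m, n)) :
  p *m q^t* = 0 -> p' *m q'^t* = 0 ->
  sqnorm (p^t* *m p - p'^t* *m p') <=
  sqnorm (p^t* *m p - q^t* *m q - (p'^t* *m p' - q'^t* *m q')).
Proof.
move=> pq pq'.
set c := p^t* *m p; set c' := p'^t* *m p'.
set d := q^t* *m q; set d' := q'^t* *m q'.
have -> : c - d - (c' - d') = (c - c') - (d - d') 
  by rewrite !opprB [d' - c']addrC addrACA [- d + d']addrC.
have hg (b : 'M[C]_(m, n)) : (b^t* *m b)^t* = b^t* *m b by rewrite adjM trmxCK.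
have hc : (c - c')^t* = c - c' by rewrite adjB !hg.
have hd : (d - d')^t* = d - d' by rewrite adjB !hg.
have cd : c *m d = 0 by rewrite /c /d mulmxA -[_ *m p *m _]mulmxA pq mulmx0
  mul0mx.
have cd' : c' *m d' = 0.
  by rewrite /c' /d' mulmxA -[_ *m p' *m _]mulmxA pq' mulmx0 mul0mx.
have tr_ge0 (u w : 'M[C]_(m, n)) : 0 <= \tr ((u^t* *m u) *m (w^t* *m w)).
  rewrite mulmxA mxtrace_mulC !mulmxA -mulmxA.
  have -> : u *m w^t* = (w *m u^t*)^t* by rewrite adjM trmxCK.
  by rewrite -sqnormE sqnorm_ge0.
rewrite -subr_ge0 !sqnormE adjB hc hd.
have sqB (A B : 'M[C]_n) :
  (A - B) *m (A - B) = A *m A - A *m B - B *m A + B *m B.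
  by rewrite mulmxBl !mulmxBr opprB addrA addrAC.
rewrite sqB {sqB}.
have trE (A B D E : 'M[C]_n) :
  \tr (A - B - D + E) = \tr A - \tr B - \tr D + \tr E.
  by rewrite mxtraceD !raddfB.
rewrite trE {trE} [X in _ - _ - X + _]mxtrace_mulC.
(* As [c *m d] and [c' *m d'] vanish, only mixed products remain. Their traces are nonnegative, so
   the cross term of the square can only enlarge the right-hand side. *)
have -> : \tr ((c - c') *m (d - d')) = - (\tr (c *m d') + \tr (c' *m d)).
  have trE (A B : 'M[C]_n) : \tr (- A - B) = - (\tr A + \tr B).
    by rewrite raddfB raddfN /= opprD.
  by rewrite mulmxBl !mulmxBr cd cd' sub0r subr0 trE.
set t := \tr _; set t1 := \tr (c *m d'); set t2 := \tr (c' *m d).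
have -> : t - - (t1 + t2) - - (t1 + t2) + \tr ((d - d') *m (d - d')) - t
  = (t1 + t2) *+ 2 + sqnorm (d - d') by rewrite sqnormE hd; ring.
by rewrite addr_ge0 ?sqnorm_ge0 // mulrn_wge0 // addr_ge0 // tr_ge0.
Qed.

(** By [truncation_shift_lip] the shift moves by at most [n e], so the entries of [a - x] move by at
    most [(n + 1) e]. The contraction property of the positive part is then applied to a matrix with
    [n^2] such entries. *)
Lemma truncation_lip n k (a a' : 'M[C]_n) x x' p q p' q' (e : C) :
  truncation k a x p q -> truncation k a' x' p' q' ->
  (forall i j, `|a i j - a' i j| <= e) ->
  forall i j, `|(p^t* *m p) i j - (p'^t* *m p') i j| <= n%:R * (n%:R + 1) * e.
Proof.
move=> t t' ae i j.
have e0 : 0 <= e by apply: le_trans (ae i j).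
have xx : `|x - x'| <= n%:R * e.
  have [rx rx'] : x \is Num.real /\ x' \is Num.real by case: t t' =>
    ? ? ? ? ? [].
  rewrite real_ler_norml ?rpredB //; apply/andP; split.
    by rewrite lerNl opprB; exact: truncation_shift_lip t t' ae.
  apply: (truncation_shift_lip t' t) => i' j'; rewrite distrC; exact: ae.
case: t t' => [_ ax pq _ _] [_ ax' pq' _ _].
rewrite -(@ler_pXn2r _ 2) ?nnegrE ?normr_ge0 //; last first.
  by rewrite !mulr_ge0 // addr_ge0.
have := sqnorm_entry (p^t* *m p - p'^t* *m p') i j.
have -> (A B : 'M[C]_n) : (A - B) i j = A i j - B i j by rewrite !mxE.
move=> /le_trans; apply.
apply: le_trans (sqnorm_gramB_le pq pq') _; rewrite -ax -ax'.
have -> : (n%:R * (n%:R + 1) * e) ^+ 2 =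
    \sum_(i < n) \sum_(j < n) ((n%:R + 1) * e) ^+ 2.
  by rewrite !sumr_const card_ord -[in RHS]mulr_natl -[in RHS]mulr_natl; ring.
apply: ler_sum => u _; apply: ler_sum => w _.
rewrite ler_pXn2r ?nnegrE ?normr_ge0 ?mulr_ge0 ?addr_ge0 //.
rewrite !mxE.
have -> : a u w - x *+ (u == w) - (a' u w - x' *+ (u == w)) =
  (a u w - a' u w) - (x - x') *+ (u == w) by rewrite mulrnBl; ring.
apply: le_trans (ler_normB _ _) _; rewrite mulrDl mul1r addrC lerD //.
case: (u == w); rewrite ?mulr1n // mulr0n normr0.
by rewrite mulr_ge0.
Qed.

(** Among the [i] with at most [k] strictly larger values, one with the most of them is taken. If at
    most [k] values were [>= D i], the next smaller value would be admissible too, with a larger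
    count. *)
Lemma order_statistic (T : finType) (D : T -> C) k :
  (forall i, D i \is Num.real) -> (k < #|T|)%N ->
  exists i, (#|[pred j | D i < D j]%R| <= k)%N /\
            (#|[pred j | D j < D i]%R| + k < #|T|)%N.
Proof.
move=> rD kT; pose g i := #|[pred j | D i < D j]%R|.
have g_lt i j : D i < D j -> (g j < g i)%N.
  move=> ij; apply: proper_card; apply/properP; split.
    by apply/fintype.subsetP => m; rewrite !inE; apply: lt_trans.
  by exists j; rewrite !inE ?ltxx.
have [i1 _] : exists i : T, i \in T by apply/card_gt0P; apply: leq_ltn_trans kT.
have [i0 gi0] : exists i, (g i <= k)%N.
  case: (arg_minnP g (erefl : xpredT i1)) => i _ gmin; exists i.
  rewrite [g i]eq_card0 // => j; rewrite !inE; apply/negP => /g_lt.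
  by rewrite ltnNge gmin.
case: (@arg_maxnP _ i0 (fun i => g i <= k)%N g gi0) => i gi gmax.
exists i; split => //.
have cC : (#|[pred j | D i <= D j]%R| + #|[pred j | D j < D i]%R|)%N = #|T|.
  rewrite -[RHS](cardC [pred j | D i <= D j]); congr addn.
  by apply: eq_card => j; rewrite !inE real_ltNge.
rewrite -[X in (_ < X)%N]cC addnC ltn_add2r ltnNge; apply/negP => le_k.
have [j1 j1i] : exists j, j \in [pred j | D j < D i].
  apply/card_gt0P; rewrite -(ltn_add2l #|[pred j | D i <= D j]%R|) addn0 cC.
  exact: leq_ltn_trans kT.
case: (@arg_minnP _ j1 [pred j | D j < D i] g j1i) => j; rewrite inE => ji gmin.
have gj : g j = #|[pred m | D i <= D m]%R|.
  apply: eq_card => m; rewrite !inE; apply/idP/idP; last exact: lt_le_trans.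
  apply: contraTT; rewrite -real_ltNge // => mi; apply/negP => jm.
  by have := gmin m mi; rewrite leqNgt g_lt.
by have := gmax j; rewrite gj le_k -gj => /(_ isT); rewrite /= leqNgt g_lt.
Qed.

Lemma diag_gram n (P : 'M[C]_n) (s t : 'rV[C]_n) :
  (diag_mx s *m P)^t* *m (diag_mx t *m P) =
  P^t* *m diag_mx (\row_j ((s 0 j)^* * t 0 j)) *m P.
Proof.
rewrite adjM !mulmxA; congr (_ *m _); rewrite -!mulmxA; congr (_ *m _).
rewrite tr_diag_mx map_diag_mx mulmx_diag; congr diag_mx.
by apply/rowP => j; rewrite !mxE.
Qed.

Lemma psd_spectral n (b : 'M[C]_n) : psd b ->
  exists (P : 'M[C]_n) (D : 'rV[C]_n), [/\ P *m P^t* = 1%:M, P^t* *m P = 1%:M,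
    forall i, 0 <= D 0 i & b = P^t* *m diag_mx D *m P].
Proof.
move=> pb; have hb : b \is hermsymmx.
  by apply/is_hermitianmxP; rewrite expr0 scale1r psd_herm.
have /orthomx_spectralP := hermitian_normalmx hb.
have uP := spectral_unitarymx b; rewrite invmx_unitary // => bE.
have PP := elimT unitarymxP uP.
exists (spectralmx b), (spectral_diag b); split => //.
  by rewrite -invmx_unitary // mulVmx // unitarymx_unit.
(* The eigenvalues are the values of the quadratic form at the columns of [P^t*]. *)
move=> i; have := pb ((spectralmx b)^t* *m delta_mx i 0).
rewrite [in X in _ *m X *m _]bE adjM trmxCK !mulmxA.
rewrite -[_ *m spectralmx b *m _]mulmxA PP mulmx1.
rewrite -[_ *m spectralmx b *m _]mulmxA PP mulmx1.
by rewrite quad_delta !mxE eqxx mulr1n.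
Qed.

(** With [x] the (k+1)-st largest eigenvalue, [p] and [q] are [P] with its rows scaled by the square
    roots of the positive and negative parts of [D - x]. At most [k] eigenvalues exceed [x] and
    fewer than [n - k] lie below it. *)
Lemma psd_truncation n k (b : 'M[C]_n) : (k < n)%N -> psd b ->
  exists x p q, truncation k b x p q.
Proof.
move=> kn pb; have [P [D [PP PP' D0 bE]]] := psd_spectral pb.
have rD i : D 0 i \is Num.real by rewrite ger0_real.
have [|i0 [gt_k lt_k]] := @order_statistic _ (D 0) k rD;
  first by rewrite card_ord.
pose x := D 0 i0; rewrite card_ord in lt_k.
pose s := \row_j (if x < D 0 j then sqrtC (D 0 j - x) else 0).
pose t := \row_j (if D 0 j < x then sqrtC (x - D 0 j) else 0).
exists x, (diag_mx s *m P), (diag_mx t *m P); split.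
- exact: rD.
- rewrite !diag_gram {1}bE -[x%:M]mulmx1 -PP' mul_scalar_mx scalemxAr -mulmxA.
  rewrite -[x *: P]mul_scalar_mx -mulmxBr -mulmxBl mulmxA -[in RHS]mulmxBl
    -mulmxBr.
  congr (_ *m _ *m _); rewrite -diag_const_mx -!linearB; congr diag_mx.
  apply/rowP => j; rewrite !mxE.
  have [lt|gt|eq] := real_ltgtP (rD j) (rD i0); rewrite -/x.
  + rewrite rmorph0 mul0r add0r geC0_conj ?sqrtC_ge0 ?subr_ge0 ?ltW //.
    by rewrite -expr2 sqrtCK opprB.
  + rewrite rmorph0 mul0r subr0 geC0_conj ?sqrtC_ge0 ?subr_ge0 ?ltW //.
    by rewrite -expr2 sqrtCK.
  + by rewrite eq !rmorph0 !mul0r !subrr.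
- rewrite adjM mulmxA -[_ *m P *m _]mulmxA PP mulmx1 tr_diag_mx map_diag_mx.
  rewrite mulmx_diag -(raddf0 (@diag_mx _ n)); congr diag_mx.
  apply/rowP => j; rewrite !mxE.
  have [lt|gt|eq] := real_ltgtP (rD j) (rD i0); rewrite -/x ?mul0r //.
  by rewrite rmorph0 mulr0.
- apply: leq_trans (mxrankM_maxl _ _) _; apply: leq_trans (rank_diag_le _) _.
  apply: leq_trans gt_k; apply: subset_leq_card; apply/fintype.subsetP => j.
  by rewrite !inE mxE; case: ifP => //; rewrite eqxx.
- apply: leq_ltn_trans lt_k; rewrite leq_add2r.
  apply: leq_trans (mxrankM_maxl _ _) _; apply: leq_trans (rank_diag_le _) _.
  apply: subset_leq_card; apply/fintype.subsetP => j.
  by rewrite !inE mxE; case: ifP => //; rewrite eqxx.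
Qed.

Lemma psd_gram_rank n (b : 'M[C]_n) : psd b ->
  exists p : 'M[C]_n, b = p^t* *m p /\ (\rank p <= \rank b)%N.
Proof.
move=> pb; have [P [D [PP PP' D0 bE]]] := psd_spectral pb.
pose s := \row_j sqrtC (D 0 j); exists (diag_mx s *m P); split.
  rewrite diag_gram {1}bE; congr (_ *m diag_mx _ *m _).
  apply/rowP => j; rewrite !mxE geC0_conj ?sqrtC_ge0 //.
  by rewrite -expr2 sqrtCK.
(* The factor [b] on the right bounds the rank; a zero eigenvalue gives a zero row on both sides. *)
have -> : diag_mx s *m P = (diag_mx (\row_j (s 0 j)^-1) *m P) *m b.
  rewrite bE !mulmxA -[_ *m P *m _]mulmxA PP mulmx1 mulmx_diag.
  congr (diag_mx _ *m _); apply/rowP => j; rewrite !mxE.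
  have [->|nz] := eqVneq (D 0 j) 0; first by rewrite sqrtC0 mulr0.
  by rewrite -[X in _^-1 * X]sqrtCK expr2 mulKf // sqrtC_eq0.
exact: mxrankM_maxr.
Qed.

(** Gaussian elimination provides [P] and [Q]. They replace the choice of a nonzero minor and, with
    [rank_ge_det], express a lower bound on the rank by a determinant, which makes it an open
    condition. *)
Lemma rank_ge_minor n l (b : 'M[C]_n) : (l <= \rank b)%N ->
  exists (P : 'M[C]_(l, n)) (Q : 'M[C]_(n, l)), P *m b *m Q = 1%:M.
Proof.
move=> lb.
exists (pid_mx l *m invmx (col_ebase b)), (invmx (row_ebase b) *m pid_mx l).
rewrite -{2}(mulmx_ebase b) !mulmxA mulmxKV ?col_ebase_unit //.
rewrite mulmxK ?row_ebase_unit // mul_pid_mx -[RHS]pid_mx_1.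
rewrite mul_pid_mx; congr pid_mx.
by have := leq_trans lb (rank_leq_row b); lia.
Qed.

Lemma rank_ge_det n l (P : 'M[C]_(l, n)) (Q : 'M[C]_(n, l)) (b : 'M[C]_n) :
  \det (P *m b *m Q) != 0 -> (l <= \rank b)%N.
Proof.
rewrite -unitfE => u; have : P *m b *m Q \in unitmx by rewrite unitmxE.
move=> /mxrank_unit <-.
exact: leq_trans (mxrankM_maxl _ _) (mxrankM_maxr _ _).
Qed.

End Psd.

(** * Extension of maps from spheres *)

Lemma cvg_mx (S : Type) (T : topologicalType) m n (F : set_system S)
    {FF : Filter F} (f : S -> 'M[T]_(m, n)) (a : 'M[T]_(m, n)) :
  (forall i j, (fun s => f s i j) @ F --> a i j) -> f @ F --> a.
Proof.
move=> fa A [P aP PA]; apply: filterS (PA) _.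
apply: (filter_forall (f := fun i => [set s | forall j, P i j (f s i j)])) => i.
apply: (filter_forall (f := fun j => [set s | P i j (f s i j)])) => j.
exact: fa.
Qed.

Lemma cvg_coord (S : Type) (T : topologicalType) m n (F : set_system S)
    {FF : Filter F} (f : S -> 'M[T]_(m, n)) (a : 'M[T]_(m, n)) i j :
  f @ F --> a -> (fun s => f s i j) @ F --> a i j.
Proof.
move=> fa A aA; apply: (fa [set M | A (M i j)]).
exists (fun i' j' => if (i' == i) && (j' == j) then A else setT).
  move=> i' j'; case: ifP => [/andP[/eqP-> /eqP->] //|_]; exact: filterT.
by move=> M /(_ i j); rewrite !eqxx.
Qed.

(** * Continuity of maps built from continuous maps *)

Section Combinators.
Variables (S : topologicalType).

Lemma continuous_mx (T : topologicalType) m n (f : S -> 'M[T]_(m, n)) :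
  (forall i j, continuous (fun s => f s i j)) -> continuous f.
Proof. by move=> cf x; apply: cvg_mx => i j; exact: cf. Qed.

Lemma continuous_entry (T : topologicalType) m n (f : S -> 'M[T]_(m, n)) i j :
  continuous f -> continuous (fun s => f s i j).
Proof. by move=> cf x; apply: cvg_coord; exact: cf. Qed.

Lemma continuous_add (K : numFieldType) (V : normedModType K) (f g : S -> V) :
  continuous f -> continuous g -> continuous (fun s => f s + g s).
Proof. by move=> cf cg x; apply: cvgD; [exact: cf | exact: cg]. Qed.

Lemma continuous_sub (K : numFieldType) (V : normedModType K) (f g : S -> V) :
  continuous f -> continuous g -> continuous (fun s => f s - g s).
Proof. by move=> cf cg x; apply: cvgB; [exact: cf | exact: cg]. Qed.

Lemma continuous_scale (K : numFieldType) (V : normedModType K)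
    (f : S -> K) (g : S -> V) :
  continuous f -> continuous g -> continuous (fun s => f s *: g s).
Proof. by move=> cf cg x; apply: cvgZ; [exact: cf | exact: cg]. Qed.

Lemma continuous_mul (K : numFieldType) (f g : S -> K) :
  continuous f -> continuous g -> continuous (fun s => f s * g s).
Proof. by move=> cf cg x; apply: cvgM; [exact: cf | exact: cg]. Qed.

Lemma continuous_prod (K : numFieldType) (I : finType) (f : I -> S -> K) :
  (forall i, continuous (f i)) -> continuous (fun s => \prod_i f i s).
Proof.
by move=> cf; apply: continuous_big => // ; exact: mul_continuous.
Qed.

Lemma continuous_sum (K : numFieldType) (V : normedModType K) (I : finType)
    (f : I -> S -> V) :
  (forall i, continuous (f i)) -> continuous (fun s => \sum_i f i s).
Proof.
by move=> cf; apply: continuous_big => // ; exact: add_continuous.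
Qed.

Lemma continuous_cst (T : topologicalType) (y : T) :
  continuous (fun _ : S => y).
Proof. by move=> x; exact: cvg_cst. Qed.

Lemma continuous_pair (T U : topologicalType) (f : S -> T) (g : S -> U) :
  continuous f -> continuous g -> continuous (fun s => (f s, g s)).
Proof. by move=> cf cg x; apply: cvg_pair; [exact: cf | exact: cg]. Qed.

Lemma continuous_o (T U : topologicalType) (f : T -> U) (g : S -> T) :
  continuous f -> continuous g -> continuous (fun s => f (g s)).
Proof. by move=> cf cg x; apply: continuous_comp; [exact: cg | exact: cf]. Qed.

End Combinators.

Lemma within_glue (S T : topologicalType) (A B : set S) (f g h : S -> T) :
  closed A -> closed B ->
  {within A, continuous f} -> {within B, continuous g} ->
  (forall x, A x -> h x = f x) -> (forall x, B x -> h x = g x) ->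
  {within A `|` B, continuous h}.
Proof.
move=> cA cB cf cg hf hg; apply: withinU_continuous => //.
  by apply: subspace_eq_continuous cf => x; rewrite inE => /hf.
by apply: subspace_eq_continuous cg => x; rewrite inE => /hg.
Qed.

(** Since [g] takes a whole neighbourhood of [x] into [A], neighbourhoods of [g x] relative to [A]
    suffice. *)
Lemma within_comp_at (S T U : topologicalType) (A : set T) (f : T -> U)
    (g : S -> T) x :
  {within A, continuous f} -> {for x, continuous g} ->
  (\forall y \near x, A (g y)) -> {for x, continuous (f \o g)}.
Proof.
move=> /subspace_continuousP cf cg Ag P Px.
have fP : nbhs (g x) [set y | A y -> P (f y)].
  exact: cf (nbhs_singleton Ag) P Px.
have h : nbhs x [set y | A (g y) -> P (f (g y))] := cg _ fP.
suff : nbhs x [set y | P (f (g y))] by [].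
by apply: filterS2 Ag h => y Agy; apply.
Qed.

Lemma within_comp (S T U : topologicalType) (A : set T) (f : T -> U)
    (g : S -> T) :
  {within A, continuous f} -> continuous g -> (forall x, A (g x)) ->
  continuous (f \o g).
Proof.
move=> cf cg Ag x; apply: within_comp_at => //; first exact: cg.
exact: nearW.
Qed.

Section Normalize.
Variables (R : numFieldType) (V : normedModType R).

Lemma continuous_normalize (y : V) :
  y != 0 -> {for y, continuous (fun z : V => `|z|^-1 *: z)}.
Proof.
move=> y0; apply: cvgZ; last exact: cvg_id.
by apply: cvgV; [rewrite normr_eq0 | exact: norm_continuous].
Qed.

Lemma near_neq0 (y : V) : y != 0 -> \forall z \near y, z != 0.
Proof.
move=> y0; apply: open_nbhs_nbhs; split; last exact: y0.
rewrite (_ : (fun z : V => is_true (z != 0)) = ~` [set 0]); last first.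
  by apply/seteqP; split => z /eqP.
exact/closed_openC/accessible_closed_set1/hausdorff_accessible/norm_hausdorff.
Qed.

End Normalize.

(** * Clamping real numbers to the unit interval *)

Section UnitClamp.
Variable R : realType.

Definition clamp (x : R) : R := Num.min (Num.max x 0) 1.

Lemma clamp_ge0 x : 0 <= clamp x.
Proof. by rewrite le_min le_max lexx orbT ler01. Qed.

Lemma clamp_le1 x : clamp x <= 1.
Proof. by rewrite ge_min lexx orbT. Qed.

Lemma clamp_itv x : 0 <= clamp x <= 1.
Proof. by rewrite clamp_ge0 clamp_le1. Qed.

Lemma clamp_id x : 0 <= x <= 1 -> clamp x = x.
Proof. by move=> /andP[x0 x1]; rewrite /clamp max_l // min_l. Qed.

Lemma clamp1 x : 1 <= x -> clamp x = 1.
Proof. by move=> x1; rewrite /clamp min_r // le_max x1. Qed.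

Lemma clamp0 x : x <= 0 -> clamp x = 0.
Proof. by move=> x0; rewrite /clamp max_r // min_l. Qed.

Lemma continuous_clamp : continuous clamp.
Proof.
move=> x; apply: (@continuous_min R R (fun x => Num.max x 0) (fun=> 1)).
  apply: (@continuous_max R R id (fun=> 0)); [exact: cvg_id | exact: cvg_cst].
exact: cvg_cst.
Qed.

End UnitClamp.

(** * Filling in maps given off the origin, spheres being those of the sup norm *)

Section SphereExtension.
Variables (R : realType) (r : nat).
Implicit Types (x : 'rV[R]_r.+1) (z : 'rV[R]_r) (t : R).

(** The product vanishes on the boundary of the cube and is 1 at its centre. *)
Definition bump t z := t * \prod_i (4 * z 0 i * (1 - z 0 i)).

(* The point (2a - 1, a(2z - 1)), where a = [bump t z]; it is the center
   (-1, 0) of a face wherever the bump vanishes. *)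
Definition pinch t z : 'rV[R]_r.+1 :=
  \row_j (if unlift ord0 j is Some i then bump t z * (2 * z 0 i - 1)
          else 2 * bump t z - 1).

Lemma bump_itv t z : 0 <= t <= 1 -> cube R r z -> 0 <= bump t z <= 1.
Proof.
move=> /andP[t0 t1] cz.
have p i : 0 <= 4 * z 0 i * (1 - z 0 i) <= 1.
  have /andP[z0 z1] := cz i; rewrite !mulr_ge0 ?subr_ge0 //=.
  by have := sqr_ge0 (2 * z 0 i - 1); nra.
have p0 : 0 <= \prod_i (4 * z 0 i * (1 - z 0 i)).
  by apply: prodr_ge0 => i _; case/andP: (p i).
have p1 : \prod_i (4 * z 0 i * (1 - z 0 i)) <= 1.
  by apply: prodr_ile1 => i _; exact: p.
by rewrite /bump; apply/andP; split; nra.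
Qed.

Lemma bump_boundary t z : cube_boundary R r z -> bump t z = 0.
Proof.
move=> [_ [i zi]]; rewrite /bump (bigD1 i) //=.
by case: zi => ->; rewrite ?mulr0 ?subrr ?mulr0 ?mul0r ?mulr0.
Qed.

Lemma pinch_bump0 t t' z z' : bump t z = 0 -> bump t' z' = 0 ->
  pinch t z = pinch t' z'.
Proof.
move=> b b'; apply/rowP => j; rewrite !mxE b b'.
by case: unlift => [i|//]; rewrite !mul0r.
Qed.

Lemma continuous_bump (S : topologicalType) (f : S -> R) (g : S -> 'rV[R]_r) :
  continuous f -> continuous g -> continuous (fun s => bump (f s) (g s)).
Proof.
move=> cf cg; apply: continuous_mul => //; apply: continuous_prod => i.
apply: continuous_mul.
  by apply: continuous_mul; [exact: continuous_cst | exact: continuous_entry].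
by apply: continuous_sub; [exact: continuous_cst | exact: continuous_entry].
Qed.

Lemma continuous_pinch (S : topologicalType) (f : S -> R) (g : S -> 'rV[R]_r) :
  continuous f -> continuous g -> continuous (fun s => pinch (f s) (g s)).
Proof.
move=> cf cg; apply: continuous_mx => i j.
have cb := continuous_bump cf cg.
under eq_fun do rewrite mxE.
case: unlift => [k|].
  apply: continuous_mul => //; apply: continuous_sub;
    last exact: continuous_cst.
  by apply: continuous_mul; [exact: continuous_cst | exact: continuous_entry].
apply: continuous_sub; last exact: continuous_cst.
by apply: continuous_mul => //; exact: continuous_cst.
Qed.

(** Together with [tail_coord], this identifies the ball of radius 1/2 of the sup norm with the unit
    cube of dimension [r + 1]. *)
Definition head_coord x := clamp (x 0 0 + 2^-1).
Definition tail_coord x : 'rV[R]_r := \row_i clamp (x 0 (lift ord0 i) + 2^-1).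
(** Equal to 1 on the ball of radius 1/2 and to 0 outside the open unit ball, so that [push]
    interpolates between [pinch] and the identity. *)
Definition shrink x := clamp (2 - 2 * `|x|).
Definition push x := (1 - shrink x) *: x +
  shrink x *: pinch (head_coord x) (tail_coord x).

Lemma tail_cube x : cube R r (tail_coord x).
Proof. by move=> i; rewrite mxE clamp_itv. Qed.

Let continuous_id_entry n (j : 'I_n) : continuous (fun y : 'rV[R]_n => y 0 j).
Proof. exact: coord_continuous. Qed.

Lemma continuous_head : continuous head_coord.
Proof.
apply: continuous_o; first exact: continuous_clamp.
by apply: continuous_add; [exact: continuous_id_entry | exact: continuous_cst].
Qed.

Lemma continuous_tail : continuous tail_coord.
Proof.
apply: continuous_mx => i j; under eq_fun do rewrite mxE.
apply: continuous_o; first exact: continuous_clamp.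
by apply: continuous_add; [exact: continuous_id_entry | exact: continuous_cst].
Qed.

Lemma continuous_push : continuous push.
Proof.
have cs : continuous shrink.
  apply: continuous_o; first exact: continuous_clamp.
  apply: continuous_sub; first exact: continuous_cst.
  by apply: continuous_mul; [exact: continuous_cst | exact: norm_continuous].
apply: continuous_add; apply: continuous_scale => //.
- by apply: continuous_sub => //; exact: continuous_cst.
- by move=> x; exact: cvg_id.
- by apply: continuous_pinch; [exact: continuous_head | exact: continuous_tail].
Qed.

Lemma norm_row_le n (y : 'rV[R]_n) c :
    0 <= c -> (`|y| <= c) = [forall i, `|y 0 i| <= c].
Proof.
move=> c0; rewrite [`|y|]mx_normrE; apply/idP/forallP => [h i|h].
  by apply: le_trans h; apply: (le_bigmax _ (fun ij => `|y ij.1 ij.2|) (0, i)).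
by apply/bigmax_leP; split => // -[i j] _ /=; rewrite ord1.
Qed.

Lemma norm_row_attained x : exists j, `|x 0 j| = `|x|.
Proof.
have [x0|x0] := eqVneq `|x| 0.
  by exists 0; move/eqP: x0; rewrite normr_eq0 => /eqP->; rewrite mxE !normr0.
by have [[i j] e] := mx_norm_neq0 x0; exists j; rewrite [RHS]e /= ord1.
Qed.

(** As [y] and [c] have the same sign, multiplying the sum by [y] makes it positive. *)
Lemma comb_neq0 (u v y c : R) : 0 <= u -> 0 <= v -> 0 < u + v -> 0 < y * c ->
  u * y + v * c != 0.
Proof.
move=> u0 v0 uv yc; apply/eqP => /(congr1 ( *%R y)); rewrite mulr0.
have y0 : 0 < y ^+ 2 by rewrite exprn_even_gt0 //=; apply: contraTneq yc => ->;
  rewrite mul0r ltxx.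
have -> : y * (u * y + v * c) = u * y ^+ 2 + v * (y * c) by ring.
have := mulr_ge0 u0 (ltW y0); have := mulr_ge0 v0 (ltW yc).
have [u1|u1] := ltP 0 u; first by have := mulr_gt0 u1 y0; lra.
have v1 : 0 < v by lra.
by have := mulr_gt0 v1 yc; lra.
Qed.

Lemma clamp_sign (y : R) : y != 0 -> 0 < y * (2 * clamp (y + 2^-1) - 1).
Proof.
move=> y0; have y2 : 0 < y ^+ 2 by rewrite exprn_even_gt0 //= y0.
have [?|?] := leP y (- 2^-1); first by rewrite clamp0; nra.
have [?|?] := leP 2^-1 y; first by rewrite clamp1; nra.
by rewrite clamp_id; nra.
Qed.

(** If [shrink x = 1] and the bump is 0, the head of [push x] is -1. Otherwise each tail entry
    combines numbers of equal sign with weights not both 0, so that [push x = 0] forces the tail of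
    [x] to vanish. The bump is then [head_coord x], which is 0 or 1 because the head of [x] has
    absolute value at least 1/2, and the two terms of the head of [push x] cannot cancel. *)
Lemma push_neq0 x : 2^-1 <= `|x| -> push x != 0.
Proof.
move=> xge; apply/eqP => /rowP px.
have s01 := clamp_itv (2 - 2 * `|x|); rewrite -/(shrink x) in s01.
have b01 := bump_itv (clamp_itv _) (tail_cube x) (t := head_coord x).
set b := bump _ _ in b01.
have x_head : (1 - shrink x) * x 0 0 + shrink x * (2 * b - 1) = 0.
  by have := px 0; rewrite !mxE unlift_none.
have x_tail i : (1 - shrink x) * x 0 (lift ord0 i) +
    shrink x * (b * (2 * clamp (x 0 (lift ord0 i) + 2^-1) - 1)) = 0.
  by have := px (lift ord0 i); rewrite !mxE liftK mxE.
have [/andP[/eqP s1 /eqP b0]|] := boolP ((shrink x == 1) && (b == 0)).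
  by move: x_head; rewrite s1 b0; lra.
move=> sb.
have pos : 0 < (1 - shrink x) + shrink x * b.
  move: sb s01 b01; rewrite negb_and !neq_lt.
  by case/orP => /orP[] ? /andP[? ?] /andP[? ?]; nra.
have tail0 i : x 0 (lift ord0 i) = 0.
  have := x_tail i; rewrite mulrA; set y := x 0 _ => eq0.
  apply/eqP; apply: contraT => /clamp_sign yc.
  have /andP[s0 s1] := s01; have /andP[b0 b1] := b01.
  have u0 : 0 <= 1 - shrink x by lra.
  have := comb_neq0 u0 (mulr_ge0 s0 b0) pos yc.
  by rewrite eq0 eqxx.
have b_head : b = head_coord x.
  rewrite /b /bump big1 ?mulr1 // => i _.
  by rewrite mxE tail0 add0r clamp_id; lra.
have xh : 2^-1 <= `|x 0 0|.
  have [j jx] := norm_row_attained x; rewrite -jx in xge.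
  case: (unliftP ord0 j) xge => [i ->|-> //].
  by rewrite tail0 normr0; lra.
move: x_head; rewrite b_head /head_coord.
have [x0|x0] := leP 0 (x 0 0).
  by rewrite ger0_norm // in xh; rewrite clamp1; [nra | lra].
by rewrite ltr0_norm // in xh; rewrite clamp0; [nra | lra].
Qed.

(** A zero of [pinch t z] needs a bump equal to 1/2 and then [z] at the centre of the cube, where
    the bump is [t]. *)
Lemma pinch_neq0 t z : t = 0 \/ t = 1 -> pinch t z != 0.
Proof.
move=> t01; apply/eqP => /rowP p0.
have := p0 0; rewrite !mxE unlift_none => head0.
have b12 : bump t z = 2^-1 by lra.
case: t01 => t1; first by move: b12; rewrite /bump t1 mul0r; lra.
have z12 i : z 0 i = 2^-1 by have := p0 (lift ord0 i); rewrite !mxE liftK b12;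
  lra.
move: b12; rewrite /bump t1 big1 => [|i _]; first by lra.
by rewrite z12; field.
Qed.

(** As there is only one class, the class of the constant map is that of [f], which contains [f] by
    the constant homotopy. *)
Lemma homotopic_cst (T : topologicalType) (Y : set T) y0 (f : 'rV[R]_r -> T) :
  homotopy_group_zero R Y r -> Y y0 -> sphere_map Y y0 f ->
  homotopic Y y0 (fun=> y0) f.
Proof.
move=> pi0 Yy0 sf; have [c cE] := pi0 y0 Yy0.
pose cl (g : 'rV[R]_r -> T) :=
  [set h | sphere_map Y y0 h /\ homotopic Y y0 g h].
have cl_c g : sphere_map Y y0 g -> cl g = c.
  by move=> sg; have : homotopy_group R Y y0 r (cl g); [exists g | rewrite cE].
have scst : sphere_map Y y0 (fun _ : 'rV[R]_r => y0).
  by split=> //; apply: continuous_subspaceT; exact: continuous_cst.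
suff : cl (fun=> y0) f by case.
rewrite (cl_c _ scst) -(cl_c _ sf); split => //.
exists (f \o fst); split => //.
case: sf => /subspace_continuousP cf _ _.
apply/subspace_continuousP => -[z t] [/= cz _] P Pz.
have fP : nbhs z [set y | cube R r y -> P (f y)] by exact: cf cz P Pz.
have h : nbhs (z, t) [set y : 'rV[R]_r * R | cube R r y.1 -> P (f y.1)].
  exact: (@cvg_fst _ _ (nbhs z) (nbhs t) _ _ fP).
by apply: (filterS _ h) => y yP [/yP].
Qed.

(* [push] is the identity on the unit sphere and collapses all faces but one of
   the sphere of radius 1/2 to a point. Hence [f o push] extends [f] down to the
   latter sphere, where it is a based map on a cube and can be filled in. *)
Lemma sphere_extension (T : topologicalType) (Y : set T)
    (f : 'rV[R]_r.+1 -> T) :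
  homotopy_group_zero R Y r -> (forall x, x != 0 -> {for x, continuous f}) ->
  (forall x, x != 0 -> Y (f x)) ->
  exists F : 'rV[R]_r.+1 -> T, [/\ continuous F, forall x, Y (F x) &
    forall x, 1 <= `|x| -> F x = f x].
Proof.
move=> pi0 cf Yf; pose y0 := f (pinch 0 0).
have Yy0 : Y y0 by apply/Yf/pinch_neq0; left.
pose cl z : 'rV[R]_r := \row_i clamp (z 0 i).
have cl_cube z : cube R r z -> cl z = z.
  by move=> cz; apply/rowP => i; rewrite mxE clamp_id.
have ccl : continuous cl.
  apply: continuous_mx => i j; under eq_fun do rewrite mxE.
  by apply: continuous_o;
    [exact: continuous_clamp | exact: continuous_id_entry].
(* On the sphere of radius 1/2, [f o push] is this based map on the face where the head is largest
   and [y0] on all other faces. A null homotopy, with the head coordinate as time, fills in the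
   ball. *)
have [H [cH H0 H1 Hs]] :
  homotopic Y y0 (fun=> y0) (fun z => f (pinch 1 (cl z))).
  apply: homotopic_cst => //; split => [|z _|z bz].
  - apply: continuous_subspaceT => z; apply: continuous_comp; last first.
      by apply/cf/pinch_neq0; right.
    by apply: continuous_pinch => //; exact: continuous_cst.
  - by apply/Yf/pinch_neq0; right.
  - rewrite cl_cube; last by case: bz.
    congr f; apply: pinch_bump0; first exact: bump_boundary.
    by rewrite /bump mul0r.
pose G x := H (tail_coord x, head_coord x).
have cG : continuous G.
  apply: (within_comp (g := fun x => (tail_coord x, head_coord x)) cH).
    by apply: continuous_pair;
      [exact: continuous_tail | exact: continuous_head].
  move=> x; split => /=; first exact: tail_cube.
  by rewrite in_itv /= clamp_itv.
pose F x := if `|x| <= 2^-1 then G x else f (push x).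
(* A point of this sphere has some coordinate at an end of its range. At an end of a tail
   coordinate, or at head coordinate 0, both sides are [y0]; at head coordinate 1 they agree by
   [H1]. *)
have agree x : `|x| = 2^-1 -> G x = f (push x).
  move=> x12; have -> : push x = pinch (head_coord x) (tail_coord x).
    by rewrite /push /shrink x12 clamp1 ?subrr ?scale0r ?scale1r ?add0r //; lra.
  have [j] := norm_row_attained x; rewrite x12.
  have ends (u : R) : `|u| = 2^-1 ->
    clamp (u + 2^-1) = 0 \/ clamp (u + 2^-1) = 1.
    have [u0|u0] := leP 0 u;
      [rewrite ger0_norm // | rewrite ltr0_norm //] => u12.
      by right; rewrite clamp1 //; lra.
    by left; rewrite clamp0 //; lra.
  case: (unliftP ord0 j) => [i ->|->] /ends xj.
    have bx : cube_boundary R r (tail_coord x).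
      by split; [exact: tail_cube | exists i; rewrite mxE].
    have [_ _ /(_ _ bx) e] := Hs _ (clamp_itv (x 0 0 + 2^-1)).
    transitivity y0; first exact: e.
    congr f; apply: pinch_bump0; last exact: bump_boundary.
    by rewrite /bump mul0r.
  rewrite /G; case: xj; rewrite -/(head_coord x) => ->.
    rewrite H0; last exact: tail_cube.
    by congr f; apply: pinch_bump0; rewrite /bump mul0r.
  rewrite H1; last exact: tail_cube.
  by rewrite cl_cube //; exact: tail_cube.
have /continuous_closedP norm_closed := @norm_continuous R 'rV[R]_r.+1.
exists F; split.
- have cover : [set x :
    'rV[R]_r.+1 | `|x| <= 2^-1] `|` [set x | 2^-1 <= `|x|] = setT.
    apply/seteqP; split => // x _.
    by case: (leP `|x| 2^-1) => [?|/ltW ?]; by [left|right].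
  have : {within [set x :
    'rV[R]_r.+1 | `|x| <= 2^-1] `|` [set x | 2^-1 <= `|x|], continuous F}.
    apply: (@within_glue _ _ _ _ G (f \o push)).
    + exact: (norm_closed _ (@closed_le R 2^-1)).
    + exact: (norm_closed _ (@closed_ge R 2^-1)).
    + exact: continuous_subspaceT.
    + apply: continuous_in_subspaceT => x; rewrite inE => /push_neq0 px.
      by apply: continuous_comp; [exact: continuous_push | exact: cf].
    + by move=> x /= x12; rewrite /F x12.
    + move=> x /= x12; rewrite /F; case: ifP => // x12'; apply: agree.
      by apply/eqP; rewrite eq_le x12 x12'.
  rewrite cover => cF x P Px; have := cF x P Px.
  by rewrite /= !nbhs_simpl /= nbhs_subspaceT.
- move=> x; rewrite /F; case: ifPn => [_|]; last first.
    by rewrite -ltNge => /ltW /push_neq0 /Yf.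
  by have [_ + _] := Hs _ (clamp_itv (x 0 0 + 2^-1)); apply; exact: tail_cube.
- move=> x x1; rewrite /F ifF; last by apply/negbTE; rewrite -ltNge; lra.
  by rewrite /push /shrink clamp0 ?subr0 ?scale1r ?scale0r ?addr0 //; lra.
Qed.

End SphereExtension.

(** * Extension of maps over cubical complexes *)

Section CubicalComplex.
Variables (R : realType) (q : nat).
Implicit Types (x : 'rV[R]_q) (B : {set 'I_q}) (K : {set {set 'I_q}}).

(** [B] lists the coordinates allowed to be nonzero: the face is a cube of dimension [#|B|] with 0
    as a vertex. *)
Definition face B : set 'rV[R]_q :=
  [set x | cube R q x /\ forall i, i \notin B -> x 0 i = 0].

Definition face_boundary B : set 'rV[R]_q :=
  [set x | face B x /\ exists2 i, i \in B & x 0 i = 0 \/ x 0 i = 1].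

Definition faces K : set 'rV[R]_q := [set x | exists2 B, B \in K & face B x].

(** For [K] a nerve this is its cubical subdivision, and [faces K] is the cone over it with apex
    0. *)
Definition outer_faces K : set 'rV[R]_q :=
  [set x | faces K x /\ exists i, x 0 i = 1].

Let closed_entry i (D : set R) :
  closed D -> closed [set x : 'rV[R]_q | D (x 0 i)].
Proof.
move=> cD; have /continuous_closedP := @coord_continuous R 1 q 0 i.
exact.
Qed.

Lemma closed_face B : closed (face B).
Proof.
have -> : face B = \bigcap_(i in setT)
    ([set x : 'rV[R]_q | 0 <= x 0 i] `&` [set x | x 0 i <= 1] `&`
     [set x | i \notin B -> x 0 i = 0]).
  apply/seteqP; split => x; first by move=> [cx xB] i _;
    have /andP[? ?] := cx i; split => //; exact: xB.
  move=> h; split=> [i|i]; last by case: (h i I).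
  by have [[/= -> ->]] := h i I.
apply: closed_bigI => i _; apply: closedI.
  apply: closedI; first exact: (closed_entry (@closed_ge R 0)).
  exact: (closed_entry (@closed_le R 1)).
have [iB|iB] := boolP (i \in B).
  by rewrite (_ : [set x | _] = setT); [exact: closedT | apply/seteqP; split].
rewrite (_ : [set x | _] = [set x | x 0 i = 0]).
  exact: (closed_entry (@closed_eq R 0)).
by apply/seteqP; split => x /=; [apply | move=> ->].
Qed.

Lemma closed_faces K : closed (faces K).
Proof.
have -> : faces K = \bigcup_(B in [set` K]) face B.
  by apply/seteqP; split => x [B BK xB]; exists B.
by apply: closed_bigcup => [|B _]; [exact: finite_finset | exact: closed_face].
Qed.

Lemma closed_outer_faces K : closed (outer_faces K).
Proof.
have -> : outer_faces K =
    faces K `&` \bigcup_(i in setT) [set x : 'rV[R]_q | x 0 i = 1].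
  apply/seteqP; split => x; first by case=> xK [i xi]; split => //; exists i.
  by case=> xK [i _ xi]; split => //; exists i.
apply: closedI; first exact: closed_faces.
apply: closed_bigcup => [|i _]; first exact: finite_finset.
exact: (closed_entry (@closed_eq R 1)).
Qed.

(** An enumeration of [B] identifies the boundary of the face with a unit sphere, by [beta] with
    inverse [alpha]. Composed with [alpha] and the radial projection [N], [h] is defined and
    continuous off the origin, as [sphere_extension] requires. *)
Lemma face_extension (T : topologicalType) (Y : set T) B (h : 'rV[R]_q -> T) :
  (0 < #|B|)%N -> homotopy_group_zero R Y #|B|.-1 ->
  {within face_boundary B, continuous h} ->
  (forall x, face_boundary B x -> Y (h x)) ->
  exists G : 'rV[R]_q -> T, [/\ continuous G, forall x, Y (G x) &
    forall x, face_boundary B x -> G x = h x].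
Proof.
move=> B0; set r := #|B|.-1 => pi0 ch Yh.
have Br : #|B| = r.+1 by rewrite prednK.
have /card_gt0P [j0 j0B] := B0.
pose e (i : 'I_r.+1) : 'I_q := nth j0 (enum B) i.
pose rk j : 'I_r.+1 := inord (index j (enum B)).
have eB i : e i \in B by rewrite -mem_enum mem_nth // -cardE Br.
have rkE j : j \in B -> rk j = index j (enum B) :> nat.
  by move=> jB; rewrite inordK // -Br cardE index_mem mem_enum.
have erk j : j \in B -> e (rk j) = j.
  by move=> jB; rewrite /e rkE // nth_index // mem_enum.
have rke i : rk (e i) = i.
  by apply: ord_inj; rewrite rkE //= index_uniq ?enum_uniq // -cardE Br.
pose alpha (y : 'rV[R]_r.+1) : 'rV[R]_q :=
  \row_j (if j \in B then clamp ((y 0 (rk j) + 1) / 2) else 0).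
pose beta x : 'rV[R]_r.+1 := \row_i (2 * x 0 (e i) - 1).
have c_alpha : continuous alpha.
  apply: continuous_mx => i j; under eq_fun do rewrite mxE.
  case: (j \in B); last exact: continuous_cst.
  apply: continuous_o; first exact: continuous_clamp.
  apply: continuous_mul; last exact: continuous_cst.
  by apply: continuous_add; [exact: coord_continuous | exact: continuous_cst].
have c_beta : continuous beta.
  apply: continuous_mx => i j; under eq_fun do rewrite mxE.
  apply: continuous_sub; last exact: continuous_cst.
  by apply: continuous_mul; [exact: continuous_cst | exact: coord_continuous].
have alpha_boundary y : `|y| = 1 -> face_boundary B (alpha y).
  move=> y1; split; first split => [i|i iB]; rewrite ?mxE.
  - by case: ifP => _; rewrite ?clamp_itv // lexx ler01.
  - by rewrite (negbTE iB).
  - have [j] := norm_row_attained y; rewrite y1 => yj.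
    exists (e j); rewrite ?mxE ?eB ?rke //.
    have [y0|y0] := leP 0 (y 0 j).
      by right; rewrite clamp1 //; rewrite ger0_norm // in yj; rewrite yj; lra.
    by left; rewrite clamp0 //; rewrite ltr0_norm // in yj; lra.
have beta_sphere x : face_boundary B x -> `|beta x| = 1.
  move=> [[cx _] [i iB xi]]; apply/eqP; rewrite eq_le; apply/andP; split.
    rewrite norm_row_le //; apply/forallP => j; rewrite mxE ler_norml.
    by have /andP[? ?] := cx (e j); apply/andP; split; lra.
  have := lexx `|beta x|; rewrite {1}norm_row_le // => /forallP/(_ (rk i)).
  rewrite mxE erk //; case: xi => ->; first by rewrite mulr0 sub0r normrN1.
  by rewrite mulr1 (_ : 2 - 1 = 1 :> R) ?normr1 //; lra.
have alpha_beta x : face_boundary B x -> alpha (beta x) = x.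
  move=> [[cx xB] _]; apply/rowP => j; rewrite !mxE;
    case: ifPn => [jB|/xB ->//].
  rewrite erk // clamp_id; first by field.
  by have /andP[? ?] := cx j; lra.
pose N (y : 'rV[R]_r.+1) := `|y|^-1 *: y.
have N1 y : y != 0 -> `|N y| = 1.
  by move=> y0; rewrite normrZ normfV normr_id mulVf // normr_eq0.
have [||F [cF YF Fh]] := sphere_extension (f := fun y => h (alpha (N y))) pi0.
- move=> y y0; apply: (within_comp_at (g := fun y => alpha (N y)) ch).
    by apply: continuous_comp; [exact: continuous_normalize | exact: c_alpha].
  by apply: filterS (near_neq0 y0) => z z0; apply/alpha_boundary/N1.
- by move=> y y0; apply/Yh/alpha_boundary/N1.
exists (fun x => F (beta x)); split=> [|x|x xB]; first exact: continuous_o.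
  exact: YF.
rewrite Fh ?beta_sphere // /N beta_sphere // invr1 scale1r.
by rewrite alpha_beta.
Qed.

(** Induction on the number of faces added to the outer ones. A nonempty face of largest cardinality
    meets the others exactly in its boundary, where the map is already given, and has dimension at
    most [d + 1], so it can be filled in. *)
Lemma faces_extension (T : topologicalType) (Y : set T) d y0 K
    (h : 'rV[R]_q -> T) :
  Y y0 -> (forall r, (r <= d)%N -> homotopy_group_zero R Y r) ->
  (forall B, B \in K -> (#|B| <= d.+1)%N) ->
  (forall A B : {set 'I_q}, A \subset B -> B \in K -> A \in K) ->
  {within outer_faces K, continuous h} ->
  (forall x, outer_faces K x -> Y (h x)) ->
  exists H : 'rV[R]_q -> T, [/\ {within faces K, continuous H},
    forall x, faces K x -> Y (H x), forall x, outer_faces K x -> H x = h x &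
    finset.set0 \in K -> H 0 = y0].
Proof.
move=> Yy0 pi0 K_dim K_down ch Yh.
suff ext m (K' : {set {set 'I_q}}) : #|K'| = m -> K' \subset K ->
    (forall A B : {set 'I_q}, A \subset B -> B \in K' -> A \in K') ->
    exists H : 'rV[R]_q -> T, [/\ {within outer_faces K `|` faces K',
      continuous H},
      forall x, (outer_faces K `|` faces K') x -> Y (H x),
      forall x, outer_faces K x -> H x = h x &
      finset.set0 \in K' -> H 0 = y0].
  have [//|//|H [cH YH Hh H0]] := ext _ K erefl; exists H; split => //.
    by apply: continuous_subspaceW cH => x; right.
  by move=> x Kx; apply: YH; right.
elim: m K' => [|m IH] K' K'm K'K K'_down.
  move/eqP: K'm; rewrite cards_eq0 => /eqP ->.
  have f0 : faces finset.set0 = set0 by apply/seteqP; split => // x [B];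
    rewrite inE.
  exists h; rewrite f0 setU0; split => //.
  by rewrite inE.
have /card_gt0P [B0 B0K'] : (0 < #|K'|)%N by rewrite K'm.
case: (arg_maxnP (fun B : {set 'I_q} => #|B|) B0K') => B;
  rewrite -/(B \in K') => BK' Bmax.
pose K1 := K' :\ B.
have K1m : #|K1| = m by have := cardsD1 B K'; rewrite BK' K'm => -[].
have K1K : K1 \subset K by apply: fintype.subset_trans K'K;
  apply: finset.subsetDl.
have K1_down (A C : {set 'I_q}) : A \subset C -> C \in K1 -> A \in K1.
  move=> sAC; rewrite !inE => /andP[CB CK'];
    rewrite (K'_down _ _ sAC CK') andbT.
  apply: contraNneq CB => AB; rewrite AB in sAC.
  by rewrite eq_sym eqEcard sAC; exact: Bmax.
have [H [cH YH Hh H0]] := IH K1 K1m K1K K1_down.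
(* A point of an outer face has a coordinate 1, whose index must be in [B]; a point of another face
   [C] vanishes at some index of [B] outside [C], which exists by the maximality of [#|B|]. *)
have inter x : (outer_faces K `|` faces K1) x -> face B x -> face_boundary B x.
  move=> Lx xB; split => //; case: Lx => [[_ [i xi]]|[C CK1 [_ xC]]].
    exists i; last by right.
    apply: contraT => iB; have := xB.2 i iB; rewrite xi => /eqP.
    by rewrite oner_eq0.
  have /subsetPn [i iB iC] : ~~ (B \subset C).
    move: CK1; rewrite !inE => /andP[CB CK']; apply: contra CB => BC.
    by rewrite eq_sym eqEcard BC; exact: Bmax.
  by exists i => //; left; exact: xC.
have union : outer_faces K `|` faces K' =
  (outer_faces K `|` faces K1) `|` face B.
  apply/seteqP; split => x.
    case=> [Lx|[C CK' xC]]; first by left; left.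
    have [CB|CB] := eqVneq C B; first by right; rewrite -CB.
    by left; right; exists C; rewrite // !inE CB.
  case=> [[Lx|[C]]|xB]; first by left.
    by rewrite !inE => /andP[_ CK'] xC; right; exists C.
  by right; exists B.
have closed1 : closed (outer_faces K `|` faces K1).
  by apply: closedU; [exact: closed_outer_faces | exact: closed_faces].
have [G [cG YG Gh G0]] : exists G :
  'rV[R]_q -> T, [/\ {within face B, continuous G},
    forall x, face B x -> Y (G x),
    forall x, (outer_faces K `|` faces K1) x -> face B x ->
      G x = H x & G 0 = y0].
  have [B_empty|Bn0] := posnP #|B|.
    (* The empty face is the point 0 and has empty boundary; this is where the value [y0] is
       prescribed. *)
    exists (fun=> y0); split => //;
      first exact/continuous_subspaceT/continuous_cst.
    move=> x /inter xi /xi [_ [ i ]].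
    by move/eqP: B_empty; rewrite cards_eq0 => /eqP ->; rewrite inE.
  (* A zero coordinate puts the point in the face [B :\ i], a coordinate 1 in an outer face. *)
  have sub : face_boundary B `<=` outer_faces K `|` faces K1.
    move=> x [xB [i iB]] [xi|xi].
      right; exists (B :\ i).
        rewrite !inE (K'_down _ _ (finset.subsetDl _ _) BK') andbT.
        by apply: contraTneq iB => <-; rewrite !inE eqxx.
      split; first exact: xB.1.
      move=> j; rewrite !inE negb_and negbK => /orP[/eqP -> //|]; exact: xB.2.
    left; split; last by exists i.
    by exists B; [exact: (fintype.subsetP K'K _ BK') | exact: xB].
  have [||||G [cG YG Gh]] := @face_extension _ Y B H.
  - exact: Bn0.
  - apply: pi0; rewrite -ltnS prednK //; apply: K_dim;
      exact: (fintype.subsetP K'K _ BK').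
  - exact: continuous_subspaceW cH.
  - by move=> x /sub; exact: YH.
  exists G; split => //; first exact: continuous_subspaceT.
    by move=> x Lx xB; apply: Gh; exact: inter.
  have /card_gt0P [i iB] := Bn0.
  have Z : face_boundary B 0.
    split; last by exists i => //; left; rewrite mxE.
    by split => j; rewrite mxE // lexx ler01.
  rewrite Gh //; apply: H0;
    rewrite !inE (K'_down _ _ (finset.sub0set B) BK') andbT.
  by rewrite eq_sym -card_gt0.
exists (fun x => if pselect (face B x) then G x else H x); split.
- rewrite union; apply: (within_glue (f := H) (g := G)) => //.
  + exact: closed_face.
  + by move=> x Lx; case: pselect => // xB; exact: Gh.
  + by move=> x xB; case: pselect.
- move=> x; rewrite union; case: pselect => [xB _|xB [Lx|//]].
    exact: YG.
  exact: YH.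
- move=> x Lx; case: pselect => [xB|nxB]; last exact: Hh.
  by rewrite Gh //; [exact: Hh | left].
- move=> _; case: pselect => [nf|nf]; first exact: G0.
  by exfalso; apply: nf; split => j; rewrite mxE // lexx ler01.
Qed.

End CubicalComplex.

(** * Homotopies of maps on a compact space *)

Section Homotopy.
Variables (R : realType) (K : numFieldType) (V : normedModType K).
Variables (X : topologicalType) (Y : set V).
Implicit Types f g h : X -> V.

Definition map_homotopic f g := exists G : X * R -> V,
  [/\ continuous G, forall x, G (x, 0) = f x, forall x, G (x, 1) = g x &
      forall x t, 0 <= t <= 1 -> Y (G (x, t))].

Lemma map_homotopic_refl f :
  continuous f -> (forall x, Y (f x)) -> map_homotopic f f.
Proof.
move=> cf Yf; exists (f \o fst); split => // [x|x t _]; last exact: Yf.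
by apply: continuous_comp; [exact: cvg_fst | exact: cf].
Qed.

Lemma map_homotopic_sym f g : map_homotopic f g -> map_homotopic g f.
Proof.
move=> [G [cG G0 G1 YG]]; exists (fun p => G (p.1, 1 - p.2)); split.
- apply: continuous_o => //; apply: continuous_pair; first by move=> x;
    exact: cvg_fst.
  by apply: continuous_sub; [exact: continuous_cst | by move=> x;
    exact: cvg_snd].
- by move=> x; rewrite /= subr0.
- by move=> x; rewrite /= subrr.
- by move=> x t t01; rewrite /=; apply: YG; lra.
Qed.

(* On each half of the interval, one of the first two terms of the sum below is
   constant and equal to the third, so that the sum is the concatenation. *)
Lemma map_homotopic_trans f g h :
  map_homotopic f g -> map_homotopic g h -> map_homotopic f h.
Proof.
move=> [G [cG G0 G1 YG]] [H [cH H0 H1 YH]].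
have c_snd : continuous (fun p : X * R => p.2) by move=> x; exact: cvg_snd.
have c_fst : continuous (fun p : X * R => p.1) by move=> x; exact: cvg_fst.
exists (fun p => G (p.1, clamp (2 * p.2)) + H (p.1,
  clamp (2 * p.2 - 1)) - H (p.1, 0)).
have c2 : continuous (fun p : X * R => 2 * p.2).
  by apply: continuous_mul => //; exact: continuous_cst.
split.
- apply: continuous_sub; first apply: continuous_add.
  + apply: continuous_o => //; apply: continuous_pair => //.
    by apply: continuous_o => //; exact: continuous_clamp.
  + apply: continuous_o => //; apply: continuous_pair => //.
    apply: continuous_o; first exact: continuous_clamp.
    by apply: continuous_sub => //; exact: continuous_cst.
  + by apply: continuous_o => //; apply: continuous_pair => //;
      exact: continuous_cst.
- by move=> x; rewrite /= mulr0 !clamp0 ?addrK //; lra.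
- move=> x; rewrite /= mulr1 !clamp1; [|lra|lra].
  by rewrite G1 H1 H0 addrAC subrr add0r.
- move=> x t t01 /=; have [t2|t2] := leP t 2^-1.
    by rewrite (@clamp0 _ (2 * t - 1)) ?addrK; [apply: YG;
      exact: clamp_itv | lra].
  rewrite (@clamp1 _ (2 * t)); last by lra.
  by rewrite G1 H0 addrAC subrr add0r; apply: YH; exact: clamp_itv.
Qed.

(** Compactness of [X] makes the continuity of [G] at time [t] uniform in [x], which is continuity
    of the path for the uniform topology. *)
Lemma map_homotopic_path f g : compact [set: X] -> map_homotopic f g ->
  exists p : R -> {uniform X -> V},
    [/\ {within `[0, 1], continuous p}, p 0 = f, p 1 = g
      & forall t, 0 <= t <= 1 -> continuous_maps X Y (p t)].
Proof.
move=> /compact_near_coveringP cX [G [cG G0 G1 YG]].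
have c_G t : continuous (fun x => G (x, t)).
  apply: continuous_o => //; apply: continuous_pair; last exact: continuous_cst.
  by move=> x; exact: cvg_id.
exists (fun t x => G (x, t)); split.
- apply: continuous_subspaceT => t P /uniform_nbhs [E [entE EP]].
  have h : \forall s \near t, [set: X] `<=` [set x | E (G (x, t), G (x, s))].
    apply: (cX R (nbhs t) (fun s x => E (G (x, t), G (x, s)))) => x _.
    have E2 := entourage_split_ent entE.
    (* For [z] near [x] and [s] near [t], both [G (z, t)] and [G (z, s)] are compared with
       [G (x, t)]. *)
    have nG : nbhs (x, t) [set z | split_ent E (G (x, t), G z)].
      have nG0 : nbhs (x, t) [set z | xsection (split_ent E) (G (x, t)) (G z)].
        exact: (cG (x, t) _ (nbhs_entourage _ E2)).
      by apply: filterS nG0 => z /= /xsectionP.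
    have nx : nbhs x [set z | (split_ent E)^-1%relation (G (x, t), G (z, t))].
      have nx0 : nbhs x [set z |
          xsection (split_ent E)^-1%relation (G (x, t)) (G (z, t))].
        exact: (c_G t x _ (nbhs_entourage _ (entourage_inv E2))).
      by apply: filterS nx0 => z /= /xsectionP.
    case: nG => -[A B] /= [Ax Bt] AB.
    exists (A `&` [set z | (split_ent E)^-1%relation (G (x, t), G (z, t))], B).
      by split => //; apply: filterI.
    move=> [z s] /= [[Az Gz] Bs].
    apply: (entourage_split (G (x, t))) => //.
    exact: (AB (z, s)).
  by apply: filterS h => s h; apply: EP => x _; exact: h.
- by apply/funext.
- by apply/funext.
- by move=> t t01; split=> [|x]; [exact: c_G | exact: YG].
Qed.

End Homotopy.

(** * Finite subcovers and functions subordinate to a cover *)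

Lemma finite_subcover (X : topologicalType) (U : X -> set X) :
  compact [set: X] -> (forall x, open (U x)) -> (forall x, U x x) ->
  exists D : seq X, forall y, exists2 x, x \in D & U x y.
Proof.
move=> cX oU Ux; have [[x0 _]|noX] := pselect ([set: X] !=set0); last first.
  by exists [::] => y; exfalso; apply: noX; exists y.
(* [compact_cover] is stated for pointed spaces, so [x0] is made the base point. *)
pose X' : ptopologicalType := HB.pack X (isPointed.Build X x0).
have cX' : @compact X' setT by exact: cX.
move: cX'; rewrite compact_cover => /(_ X' setT U)[x _|x _|D _ Dcov].
- exact: oU.
- by exists x => //; exact: Ux.
by exists (finmap.enum_fset D) => y; have [x /= xD Uxy] := Dcov y I; exists x.
Qed.

(** Urysohn's lemma gives, at each point, a function equal to 1 there and 0 off some [V i]. Finitely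
    many of the sets where these functions exceed 1/2 cover [X]. Doubling, summing for each [i] and
    clamping yields coordinates whose maximum, rather than sum, is 1. *)
Lemma partition_functions (R : realType) (X : topologicalType) q
    (V : 'I_q -> set X) :
  compact [set: X] -> hausdorff_space X -> (forall i, open (V i)) ->
  \bigcup_i V i = [set: X] ->
  exists phi : X -> 'rV[R]_q, [/\ continuous phi, forall x, cube R q (phi x),
    forall x i, phi x 0 i != 0 -> V i x & forall x, exists i, phi x 0 i = 1].
Proof.
move=> cX hX oV cV.
have point x : exists p : 'I_q * (X -> R), [/\ continuous p.2,
    forall y, 0 <= p.2 y, p.2 x = 1 & forall y, p.2 y != 0 -> V p.1 y].
  have : [set: X] x by []; rewrite -cV => -[i _ Vx].
  have : uniform_separator (~` V i) [set x].
    apply: normal_uniform_separator; first exact: compact_normal.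
    - exact: open_closedC.
    - exact/accessible_closed_set1/hausdorff_accessible.
    - by apply/seteqP; split => // y [/= nVy yx]; apply: nVy; rewrite yx.
  move=> /(@uniform_separatorP X R) [u [cu u01 u0 u1]].
  exists (i, u); split => //= [y||y uy].
  - have : range u (u y) by exists y.
    by move=> /u01; rewrite /= in_itv /= => /andP[].
  - by apply: u1; exists x.
  - apply: contrapT => nVy; move/eqP: uy; apply.
    by apply: u0; exists y.
have [p pP] := choice point.
have [|x|D Dcov] := @finite_subcover X (fun x => [set y | 2^-1 < (p x).2 y]) cX.
- move=> x; have [/continuousP cp _ _ _] := pP x.
  exact: (cp _ (@open_gt R 2^-1)).
- by have [_ _ /= -> _] := pP x; lra.
pose phi y : 'rV[R]_q :=
  \row_i clamp (\sum_(x <- D | (p x).1 == i) 2 * (p x).2 y).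
exists phi; split.
- apply: continuous_mx => k i; under eq_fun do rewrite mxE.
  apply: continuous_o; first exact: continuous_clamp.
  apply: continuous_big => [|x _]; first exact: add_continuous.
  by apply: continuous_mul; [exact: continuous_cst | case: (pP x)].
- by move=> x i; rewrite mxE clamp_itv.
- move=> y i; rewrite mxE => ny; apply: contrapT => nVy.
  move/eqP: ny; apply; rewrite clamp0 // big1 // => x /eqP xi.
  have [_ _ _ pV] := pP x; have [->|/pV] := eqVneq ((p x).2 y) 0;
    first by rewrite mulr0.
  by rewrite xi.
- move=> y; have [x xD /= py] := Dcov y.
  exists (p x).1; rewrite mxE clamp1 // (big_rem x) //= eqxx.
  apply: (@le_trans _ _ (2 * (p x).2 y)); first by lra.
  rewrite lerDl; apply: sumr_ge0 => z _; rewrite mulr_ge0 //.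
  by have [_ p0 _ _] := pP z.
Qed.

(** * The topology of complex matrices *)

Section ComplexMatrices.
Local Open Scope sesquilinear_scope.
Local Open Scope complex_scope.
Variable R : realType.

Lemma normc_real (x : R) : `|x%:C| = `|x|%:C.
Proof. by rewrite normc_def /= expr0n addr0 sqrtr_sqr. Qed.

Lemma gt0_complex (e : R[i]) : 0 < e -> exists2 x : R, 0 < x & e = x%:C.
Proof. by case: e => a b; rewrite ltcE /= => /andP[/eqP -> a0]; exists a. Qed.

Lemma continuous_real_complex : continuous (fun x : R => x%:C : R[i]).
Proof.
move=> x P /nbhs_ballP [_ /gt0_complex [e e0 ->] eP].
apply/nbhs_ballP; exists e => // y xy; apply: eP.
rewrite -ball_normE /ball_ /= -rmorphB normc_real ltcR.
by move: xy; rewrite -ball_normE.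
Qed.

Lemma nbhs_mx_le m n (a : 'M[R[i]]_(m, n)) (e : R) : 0 < e ->
  nbhs a [set b : 'M[R[i]]_(m, n) | forall i j, `|b i j - a i j| <= e%:C].
Proof.
move=> e0; have ec : 0 < e%:C by rewrite ltcR.
apply/nbhs_ballP; exists e%:C => // b [_ ab] i j.
by rewrite distrC; apply: ltW; exact: ab.
Qed.

Lemma mx_le_nbhs m n (a : 'M[R[i]]_(m, n)) A : nbhs a A ->
  exists2 e : R, 0 < e & forall b : 'M[R[i]]_(m, n),
    (forall i j, `|b i j - a i j| <= e%:C) -> A b.
Proof.
move=> /nbhs_ballP [_ /gt0_complex [e e0 ->] eA]; exists (e / 2);
  first by rewrite divr_gt0.
move=> b ab; apply: eA; split; first by rewrite ltcR.
move=> i j; apply: (@le_lt_trans _ _ (e / 2)%:C); last by rewrite ltcR; lra.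
by rewrite distrC; exact: ab.
Qed.

Lemma continuous_mulmx (S : topologicalType) m n p (f : S -> 'M[R[i]]_(m, n))
    (g : S -> 'M[R[i]]_(n, p)) :
  continuous f -> continuous g -> continuous (fun s => f s *m g s).
Proof.
move=> cf cg; apply: continuous_mx => i j; under eq_fun do rewrite mxE.
by apply: continuous_sum => k; apply: continuous_mul; exact: continuous_entry.
Qed.

Lemma continuous_det (S : topologicalType) n (f : S -> 'M[R[i]]_n) :
  continuous f -> continuous (fun s => \det (f s)).
Proof.
move=> cf; apply: continuous_sum => s; apply: continuous_mul.
  exact: continuous_cst.
by apply: continuous_prod => i; exact: continuous_entry.
Qed.

Lemma near_rank_ge n l (b : 'M[R[i]]_n) : (l <= \rank b)%N ->
  \forall a \near b, (l <= \rank a)%N.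
Proof.
move=> /rank_ge_minor [P [Q PbQ]].
have c : continuous (fun a : 'M[R[i]]_n => \det (P *m a *m Q)).
  apply: continuous_det; apply: continuous_mulmx; last exact: continuous_cst.
  by apply: continuous_mulmx; [exact: continuous_cst | move=> x; exact: cvg_id].
have nz : \det (P *m b *m Q) != 0 :> R[i]^o by rewrite PbQ det1 oner_eq0.
have h : \forall a \near b, \det (P *m a *m Q) != 0 := c b _ (near_neq0 nz).
by apply: filterS h => a; exact: rank_ge_det.
Qed.

(** For [k < n] a truncation is chosen for each matrix; [truncation_lip] holds whatever the choices,
    so these need not be made continuously. *)
Lemma psd_retraction n k : (k <= n)%N ->
  exists (r : 'M[R[i]]_n -> 'M[R[i]]_n) (K : R), [/\ 0 < K,
    forall a, psd a -> psd (r a) /\ (\rank (r a) <= k)%N,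
    forall a, psd a -> (\rank a <= k)%N -> r a = a &
    forall a a' (e : R), psd a -> psd a' ->
      (forall i j, `|a i j - a' i j| <= e%:C) ->
      forall i j, `|r a i j - r a' i j| <= (K * e)%:C].
Proof.
rewrite leq_eqVlt => /orP[/eqP ->|kn].
  exists id, 1; split => // [a pa|a a' e _ _ ae i j].
    by split => //; exact: rank_leq_row.
  by rewrite mul1r.
have tr (a : 'M[R[i]]_n) : exists z : R[i] * ('M[R[i]]_n * 'M[R[i]]_n),
    psd a -> truncation k a z.1 z.2.1 z.2.2.
  have [pa|npa] := pselect (psd a); last by exists (0, (0, 0)).
  by have [x [p [q t]]] := psd_truncation kn pa; exists (x, (p, q)).
have [z zP] := choice tr.
pose r a := (z a).2.1^t* *m (z a).2.1; exists r, (n%:R * (n%:R + 1) + 1).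
have K0 : (0 : R) <= n%:R * (n%:R + 1) by rewrite mulr_ge0 // addr_ge0.
have CE (e : R) : n%:R * (n%:R + 1) * e%:C = (n%:R * (n%:R + 1) * e)%:C :> R[i].
  by rewrite !rmorphM rmorphD /= rmorph1 rmorph_nat.
split => [|a pa|a pa ak|a a' e pa pa' ae i j].
- by rewrite ltr_wpDl.
- split; first exact: psd_gram.
  by apply: leq_trans (mxrankM_maxr _ _) _; case: (zP a pa).
- have [p [ap rp]] := psd_gram_rank pa.
  (* A matrix of rank at most [k] also has a truncation at 0, with positive part [a]; the Lipschitz
     bound with [e = 0] identifies it with the chosen one. *)
  have t : truncation k a 0 p 0.
    split; rewrite ?real0 // ?mulmx0 ?trmx0 ?map_mx0 ?mulmx0 ?mxrank0 //.
    - by rewrite -ap raddf0.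
    - exact: leq_trans rp ak.
  apply/matrixP => i j; rewrite [in RHS]ap.
  have := truncation_lip (zP a pa) t (e := 0) _ i j.
  rewrite mulr0 normr_le0 subr_eq0 => /(_ _)/eqP; apply.
  by move=> i' j'; rewrite subrr normr0.
- have := truncation_lip (zP a pa) (zP a' pa') ae i j; rewrite CE => /le_trans.
  apply; rewrite lecR; apply: ler_wpM2r; last by rewrite lerDl.
  by rewrite -lecR rmorph0; apply: le_trans (ae i j).
Qed.

End ComplexMatrices.

(** * Maps into matrices of bounded rank *)

Section MainProof.
Local Open Scope complex_scope.
Variables (R : realType) (n k l : nat) (r : 'M[R[i]]_n -> 'M[R[i]]_n) (K : R).
Hypotheses (K_gt0 : 0 < K)
  (r_psd : forall a, psd a -> psd (r a) /\ (\rank (r a) <= k)%N)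
  (r_id : forall a, psd a -> (\rank a <= k)%N -> r a = a)
  (r_lip : forall a a' (e : R), psd a -> psd a' ->
      (forall i j, `|a i j - a' i j| <= e%:C) ->
      forall i j, `|r a i j - r a' i j| <= (K * e)%:C).

Let Y := psd_rank R n k l.

Lemma continuous_retraction : {within [set a | psd a], continuous r}.
Proof.
apply/subspace_continuousP => a pa P /mx_le_nbhs [e e0 eP].
have h := nbhs_mx_le a (divr_gt0 e0 K_gt0).
rewrite nbhs_simpl /=; apply: filterS h => b ab pb; apply: eP => i j.
have := r_lip pb pa ab i j.
by rewrite mulrCA divff ?mulr1 // gt_eqF.
Qed.

(** As [r] fixes [y], the Lipschitz bound keeps [r a] in a neighbourhood of [y] on which the rank is
    at least [l]. *)
Lemma retraction_near y : Y y -> exists2 e : R, 0 < e &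
  forall a, psd a -> (forall i j, `|a i j - y i j| <= e%:C) -> Y (r a).
Proof.
move=> [py /andP[ly yk]]; have [e e0 eP] := mx_le_nbhs (near_rank_ge ly).
exists (e / K) => [|a pa ay]; first exact: divr_gt0.
have [pra rak] := r_psd pa; split; first exact: pra.
rewrite rak andbT; apply: eP => i j.
have := r_lip pa py ay i j; rewrite (r_id py yk).
by rewrite mulrCA divff ?mulr1 // gt_eqF.
Qed.

Variable X : topologicalType.
Hypothesis X_compact : compact [set: X].

(** Half of the margin at [x] serves at all nearby points, and compactness makes the margin
    uniform. *)
Lemma retraction_margin (f : X -> 'M[R[i]]_n) :
  continuous f -> (forall x, Y (f x)) ->
  exists2 e : R, 0 < e & forall x a, psd a ->
    (forall i j, `|a i j - f x i j| <= e%:C) -> Y (r a).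
Proof.
move=> cf Yf; pose P (e : R) x := forall a, psd a ->
    (forall i j, `|a i j - f x i j| <= e%:C) -> Y (r a).
have /compact_near_coveringP cX := X_compact.
have h : \forall e \near (0 : R)^'+, [set: X] `<=` P e.
  apply: (cX R _ P) => x _; have [d d0 dP] := retraction_near (Yf x).
  have d2 : 0 < d / 2 by rewrite divr_gt0.
  exists ([set z | forall i j, `|f z i j - f x i j| <= (d / 2)%:C],
          [set e | e <= d / 2]).
    split; last exact: nbhs_right_le.
    exact: (cf x _ (nbhs_mx_le (f x) d2)).
  move=> [z e] /= [zx ed] a pa az; apply: dP => // i j.
  rewrite -(subrK (f z i j) (a i j)) -addrA; apply: le_trans (ler_normD _ _) _.
  rewrite (_ : d%:C = (d / 2)%:C + (d / 2)%:C);
    last by rewrite -rmorphD -splitr.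
  by apply: lerD => //; apply: le_trans (az i j) _; rewrite lecR.
have [e] := @filter_ex _ (0 : R)^'+ _ _ (filterI h (nbhs_right_gt (0 : R))).
move=> [eP e0].
exists e; first exact: e0.
by move=> x a; apply: (eP x I).
Qed.

Variables (d : nat).
Hypotheses (X_hausdorff : hausdorff_space X) (X_dim : covering_dim_le X d)
  (pi_zero : forall m : nat, (m <= d)%N -> homotopy_group_zero R Y m).

(** The difference is the weighted mean of the [z j - z0], to which the triangle inequality
    applies. *)
Lemma weighted_mean_close q (w : 'I_q -> R) (z : 'I_q -> R[i]) z0 (e : R) :
  (forall j, 0 <= w j) -> 0 < \sum_j w j ->
  (forall j, w j != 0 -> `|z j - z0| <= e%:C) ->
  `|((\sum_j w j)^-1)%:C * \sum_j (w j)%:C * z j - z0| <= e%:C.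
Proof.
move=> w0 s0 we; set s := \sum_j w j in s0 *.
have sc : s%:C != 0 :> R[i] by rewrite gt_eqF // ltcR.
have -> : (s^-1)%:C * \sum_j (w j)%:C * z j - z0 =
    (s^-1)%:C * \sum_j (w j)%:C * (z j - z0).
  under [in RHS]eq_bigr do rewrite mulrBr.
  rewrite sumrB -mulr_suml -rmorph_sum -/s mulrBr.
  by rewrite [X in _ = _ - X]mulrA -rmorphM mulVf ?rmorph1 ?mul1r // gt_eqF.
have si : 0 <= s^-1 by rewrite invr_ge0 ltW.
rewrite normrM normc_real (ger0_norm si).
have -> : (s^-1)%:C = s%:C^-1 :> R[i].
  by apply: (mulfI sc); rewrite -rmorphM !mulfV ?rmorph1 // gt_eqF.
rewrite ler_pdivrMl ?ltcR // /s rmorph_sum mulr_suml.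
apply: le_trans (ler_norm_sum _ _ _) _; apply: ler_sum => j _.
rewrite normrM normc_real (ger0_norm (w0 j)) /=.
have [->|wj] := eqVneq (w j) 0; first by rewrite !mul0r.
by apply: ler_wpM2l; [rewrite lecR | exact: we].
Qed.

Lemma map_null_homotopic (f : X -> 'M[R[i]]_n) y0 :
  continuous f -> (forall x, Y (f x)) -> Y y0 -> X ->
  map_homotopic R Y f (fun=> y0).
Proof.
move=> cf Yf Yy0 x0; have [e e0 margin] := retraction_margin cf Yf.
have e2 : 0 < e / 2 by rewrite divr_gt0.
(* Values of [f] at two points of one [U p] differ by at most [e] in each entry. *)
pose U p := (f @^-1` [set b | forall i j, `|b i j - f p i j| <= (e / 2)%:C])°.
have [p|p|D Dcov] := @finite_subcover X U X_compact.
- exact: open_interior.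
- exact: (cf p _ (nbhs_mx_le (f p) e2)).
have [|| q [V [oV cV VU ord]]] := @X_dim (size D) (fun i => U (nth x0 D i)).
- by move=> i; exact: open_interior.
- apply/seteqP; split => // y _; have [x xD Uy] := Dcov y.
  have iD : (index x D < size D)%N by rewrite index_mem.
  by exists (Ordinal iD) => //=; rewrite nth_index.
have [phi [cphi phi_cube phiV phi1]] :=
  partition_functions R X_compact X_hausdorff oV cV.
(* For an empty [V j] the point [x0] is a default; such a [j] is in no member of the nerve. *)
have point j : exists p, forall x, V j x -> V j p.
  have [[x Vx]|nV] := pselect (V j !=set0); first by exists x.
  by exists x0 => x Vx; exfalso; apply: nV; exists x.
have [p pP] := choice point.
have close j x : V j x -> forall a b, `|f (p j) a b - f x a b| <= e%:C.
  move=> Vx a b; have [i Vi] := VU j; have := Vi _ Vx; have := Vi _ (pP _ _ Vx).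
  move=> /interior_subset /= /(_ a b) h1 /interior_subset /= /(_ a b) h2.
  set c := f (nth x0 D i) a b in h1 h2; rewrite -(subrK c (f (p j) a b)) -addrA.
  apply: le_trans (ler_normD _ _) _.
  rewrite (_ : e%:C = (e / 2)%:C + (e / 2)%:C);
    last by rewrite -rmorphD -splitr.
  by apply: lerD => //; rewrite distrC.
(* The nerve of the cover [V]; by [ord] its members have at most [d + 1] elements. *)
pose N : {set {set 'I_q}} :=
  [set s : {set 'I_q} | `[< exists x, forall j, j \in s -> V j x >]]%SET.
pose w (x : 'rV[R]_q) j := clamp (x 0 j).
(* The maximum with 1 keeps the denominator positive everywhere. Where some coordinate is 1, it is
   the sum of the weights, so that [avg] is a true mean there. *)
pose s x : R := Num.max 1 (\sum_j w x j).
have s_gt0 x : 0 < s x by rewrite lt_max ltr01.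
pose avg x := ((s x)^-1)%:C *: \sum_j (w x j)%:C *: f (p j).
have psd_avg x : psd (avg x).
  apply: psdZ; first by rewrite lecR invr_ge0 ltW.
  apply: psd_sum => j; first by rewrite lecR clamp_ge0.
  by case: (Yf (p j)).
have c_w j : continuous (fun x => w x j).
  by apply: continuous_o; [exact: continuous_clamp | exact: coord_continuous].
have c_s : continuous s.
  move=> x; apply: (@continuous_max R _ (fun=> 1) (fun x => \sum_j w x j)).
    exact: (@continuous_cst _ R^o 1 x).
  exact: (@continuous_sum _ R R^o _ _ c_w x).
have c_avg : continuous avg.
  apply: continuous_scale.
    apply: continuous_o; first exact: continuous_real_complex.
    by move=> x; apply: cvgV (c_s x); rewrite gt_eqF.
  apply: continuous_sum => j; apply: continuous_scale;
    last exact: continuous_cst.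
  by apply: continuous_o; first exact: continuous_real_complex.
have avg_close z x : cube R q z -> (exists i, z 0 i = 1) ->
    (forall j, z 0 j != 0 -> V j x) ->
    forall a b, `|avg z a b - f x a b| <= e%:C.
  move=> cz [i zi] zV a b.
  have w_ge0 j : 0 <= w z j by exact: clamp_ge0.
  have sE : s z = \sum_j w z j.
    rewrite /s max_r // (bigD1 i) //= {1}/w zi clamp1 // lerDl.
    by apply: sumr_ge0 => j _.
  rewrite /avg mxE summxE; under eq_bigr do rewrite mxE.
  rewrite sE; apply: weighted_mean_close => //; first by rewrite -sE.
  move=> j wj; apply: close; apply: zV; apply: contraNneq wj => zj.
  by rewrite /w zj clamp0.
have face_V (z : 'rV[R]_q) B :
  B \in N -> face B z -> exists x, forall j, z 0 j != 0 -> V j x.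
  rewrite inE => /asboolP [x xB] [_ zB]; exists x => j zj; apply: xB.
  by apply: contraNT zj => /zB ->.
have c_h : continuous (fun z => r (avg z)).
  exact: (within_comp continuous_retraction c_avg psd_avg).
have [B|A B AB|||H [cH YH Hh H0]] :=
    faces_extension (K := N) (h := fun z => r (avg z)) Yy0 pi_zero.
- rewrite inE => /asboolP [x xB]; apply: leq_trans (ord x).
  apply: subset_leq_card; apply/fintype.subsetP => j /xB Vx; rewrite inE.
  exact/asboolP.
- move=> BN; move: BN; rewrite inE => /asboolP [x xB]; rewrite inE.
  apply/asboolP; exists x => j jA; apply: xB.
  exact: (fintype.subsetP AB).
- exact: continuous_subspaceT.
- move=> z [[B BN zB] z1]; have [x zV] := face_V z B BN zB.
  by apply: (margin x) => //; apply: avg_close => //; case: zB.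
(* Scaling does not enlarge the support of [phi x], so the segment from 0 to [phi x] stays in the
   cone. *)
have phi_N c x : 0 <= c <= 1 -> faces N (c *: phi x).
  move=> /andP[c0 c1]; exists [set j | `[< V j x >]]%SET.
    by rewrite inE; apply/asboolP; exists x => j; rewrite inE => /asboolP.
  split=> j; rewrite mxE.
    by have /andP[? ?] := phi_cube x j; apply/andP; split; nra.
  rewrite inE => /asboolP nV; have [->|/phiV //] := eqVneq (phi x 0 j) 0.
  by rewrite mulr0.
have phi_outer x : outer_faces N (phi x).
  by split; [rewrite -[phi x]scale1r; apply: phi_N;
    rewrite lexx ler01 | exact: phi1].
have c_fst : continuous (fun z : X * R => z.1) by move=> z; exact: cvg_fst.
have c_clamp : continuous (fun z : X * R => clamp z.2).
  by apply: continuous_o; [exact: continuous_clamp | move=> z; exact: cvg_snd].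
have c_1clamp : continuous (fun z : X * R => 1 - clamp z.2).
  by apply: continuous_sub => //; exact: continuous_cst.
have c_phi : continuous (fun z : X * R => phi z.1) by exact: continuous_o.
apply: (@map_homotopic_trans _ _ _ _ _ _ (fun x => H (phi x))).
(* The segment from [f x] to the mean is nonnegative definite and within [e] of [f x], so [r] maps
   it into [Y]; [r] fixes its starting point. *)
- pose G (z : X * R) :=
    (1 - clamp z.2)%:C *: f z.1 + (clamp z.2)%:C *: avg (phi z.1).
  have psdG z : psd (G z).
    have /andP[? ?] := clamp_itv z.2.
    apply: psdD; apply: psdZ.
    * by rewrite lecR subr_ge0.
    * by case: (Yf z.1).
    * by rewrite lecR.
    * exact: psd_avg.
  exists (fun z => r (G z)); split => [|x|x|x t t01].
  + apply: (within_comp continuous_retraction _ psdG).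
    apply: continuous_add; apply: continuous_scale.
    * by apply: continuous_o => //; exact: continuous_real_complex.
    * exact: (continuous_o cf c_fst).
    * by apply: continuous_o => //; exact: continuous_real_complex.
    * exact: (continuous_o c_avg c_phi).
  + rewrite /G /= clamp0 // subr0 scale1r scale0r addr0.
    by have [px /andP[_ xk]] := Yf x; exact: r_id.
  + by rewrite /G /= clamp1 // subrr scale1r scale0r add0r Hh.
  + apply: (margin x) => // a b.
    rewrite /G /= clamp_id //; have /andP[t0 t1] := t01.
    have -> : ((1 - t)%:C *: f x + t%:C *: avg (phi x)) a b - f x a b =
        t%:C * (avg (phi x) a b - f x a b).
      have DE (u v : 'M[R[i]]_n) : (u + v) a b = u a b + v a b by rewrite mxE.
      have ZE c (u : 'M[R[i]]_n) : (c *: u) a b = c * u a b by rewrite mxE.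
      by rewrite DE !ZE rmorphB rmorph1; ring.
    rewrite normrM normc_real (ger0_norm t0).
    have h := avg_close (phi x) x (phi_cube x) (phi1 x) (@phiV x) a b.
    apply: le_trans h; apply: ler_piMl; first exact: normr_ge0.
    by rewrite -(rmorph1 (real_complex R)) lecR.
(* Contraction of the cone to its apex, where [H] is [y0] because the empty set belongs to the
   nerve. *)
- exists (fun z => H ((1 - clamp z.2) *: phi z.1)); split => [|x|x|x t t01].
  + apply: (within_comp cH); first exact: continuous_scale.
    by move=> z; apply: phi_N; have := clamp_itv z.2; lra.
  + by rewrite /= clamp0 // subr0 scale1r.
  + rewrite /= clamp1 // subrr scale0r H0 // inE; apply/asboolP.
    by exists x => j; rewrite inE.
  + by apply: YH; apply: phi_N; have := clamp_itv t; rewrite /=; lra.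
Qed.

End MainProof.

Theorem theorem4p6 (R : realType) (n k l : nat)
    (l_gt0 : (0 < l)%N) (le_lk : (l <= k)%N) (le_kn : (k <= n)%N)
    (d : nat) (X : topologicalType)
    (X_compact : compact [set: X]) (X_hausdorff : hausdorff_space X)
    (X_dim : covering_dim_le X d)
    (pi_zero : forall r : nat, (r <= d)%N ->
      homotopy_group_zero R (psd_rank R n k l) r) :
  path_connected R (continuous_maps X (psd_rank R n k l)).
Proof.
move=> f g [cf Yf] [cg Yg]; apply: map_homotopic_path => //.
have [r [K [K0 r_psd r_id r_lip]]] := psd_retraction R le_kn.
have null := map_null_homotopic K0 r_psd r_id r_lip X_compact X_hausdorff X_dim
  pi_zero.
have [[x0 _]|noX] := pselect ([set: X] !=set0); last first.
  have -> : g = f by apply/funext => x; exfalso; apply: noX; exists x.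
  exact: map_homotopic_refl cf Yf.
(* Both maps are contracted to the same point [f x0]. *)
apply: map_homotopic_trans (null f (f x0) cf Yf (Yf x0) x0) _.
exact: map_homotopic_sym (null g (f x0) cg Yg (Yf x0) x0).
Qed.
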